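(* Let the Löwner differential equation $$\frac{dh}{dt}=\frac{2}{h-\lambda(t)},\qquad h(z,0)\equiv z,$$ with driving term $\lambda\in\mathrm{Lip}(1/2)$ generate slit maps $h(z,t):\mathbb H\setminus\gamma_t\to\mathbb H$, where $\gamma_t\cup\overline{\gamma_t}\cup\{\gamma(0)\}$ is an analytic curve which is mapped onto $[h^-(0,t),h^+(0,t)]$. Suppose that $$\lim_{t\to+0}\frac{\lambda(t)}{\sqrt t}=c,\qquad \lim_{t\to+0}\frac{h^+(0,t)}{\sqrt t}=b,\qquad c<b\le\frac{c+\sqrt{c^2+16}}{2}.$$ Let $b_n(t)$ be the coefficients in the expansion $h^{-1}(w,t)=\sum_{n\ge1}b_n(t)(w-h^+(0,t))^{n/2}$ near $w=h^+(0,t)$. Then there are constants $A_n$, depending only on $n$, such that, given $\varepsilon>0$, there is $\delta=\delta(\varepsilon)>0$ for which, for every odd $n>1$, $$|b_n(t)|\le A_n\,t^{\frac{1}{(b-c)^2}-\frac{n-1}{4}-\varepsilon},\qquad 0<t<\delta .$$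
   Context: $\mathbb H=\{z\in\mathbb C:\operatorname{Im}z>0\}$. The driving term $\lambda$ is a real-valued continuous function on an interval $[0,T]$; $\lambda\in\mathrm{Lip}(1/2)$ means that $|\lambda(t)-\lambda(s)|\le C|t-s|^{1/2}$ for some constant $C$. ''The equation generates slit maps'' means: there is a simple arc $t\mapsto\gamma(t)$, $t\in[0,T]$, with $\gamma(0)\in\mathbb R$ and $\gamma(t)\in\mathbb H$ for $t>0$, such that, writing $\gamma_t=\gamma((0,t])$ for the slit, the solution $h(\cdot,t)$ is the conformal map of $\mathbb H\setminus\gamma_t$ onto $\mathbb H$ with $h(z,t)=z+2t/z+O(1/z^2)$ near infinity. Standing normalization: $\gamma(0)=0$, hence $\lambda(0)=0$. $\overline{\gamma_t}$ is the reflection of $\gamma_t$ in the real axis. Analyticity: in the arc-length parameter $s$, $\gamma(s)=x(s)+iy(s)$ is analytic on $[0,S]$ with $x$ even and $y$ odd, so that $\gamma_t\cup\overline{\gamma_t}\cup\{0\}$ is an analytic curve symmetric with respect to $\mathbb R$. By Schwarz reflection $h(\cdot,t)$ extends to a conformal map of $\mathbb C\setminus(\gamma_t\cup\overline{\gamma_t}\cup\{0\})$ onto $\mathbb C\setminus I(t)$, where $I(t)=[h^-(0,t),h^+(0,t)]\subset\mathbb R$ is the image of the slit; $h^-(0,t)<h^+(0,t)$ are the images of the two prime ends at $z=0$ (left and right side of the slit), and both are solutions of the Löwner equation that are singular at $t=0$, with initial value $0$. For $t>0$, near the (right) prime end at $z=0$ corresponding to $h^+(0,t)$ one has $h(z,t)=h^+(0,t)+a_2(t)z^2+a_3(t)z^3+\dots$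 with $a_2(t)\neq0$; hence the inverse function has near $w=h^+(0,t)$ the expansion $h^{-1}(w,t)=\sum_{n\ge1}b_n(t)(w-h^+(0,t))^{n/2}$, with $b_1(t)=a_2(t)^{-1/2}$ (the branch of the square root is positive for $w>h^+(0,t)$). *)

(* Defs.v *)
From Stdlib Require Import Reals Lra.
From Coquelicot Require Import Coquelicot.

Open Scope R_scope.

Definition upper_half (z : C) : Prop := 0 < Im z.

Definition setD (U V : C -> Prop) (z : C) : Prop := U z /\ ~ V z.

Definition setC (U : C -> Prop) (z : C) : Prop := ~ U z.

Definition conformal_onto (f : C -> C) (U V : C -> Prop) : Prop :=
  (forall z, U z -> @ex_derive C_AbsRing C_NormedModule f z) /\
  (forall z1 z2, U z1 -> U z2 -> f z1 = f z2 -> z1 = z2) /\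
  (forall w, V w <-> exists z, U z /\ f z = w).

Definition inverse_onto (f g : C -> C) (U V : C -> Prop) : Prop :=
  (forall z, U z -> V (f z) /\ g (f z) = z) /\
  (forall w, V w -> U (g w) /\ f (g w) = w).

(* Derivative at t relative to D: one-sided at an end point of an interval D. *)
Definition is_derive_within {V : NormedModule R_AbsRing}
    (D : R -> Prop) (f : R -> V) (t : R) (l : V) : Prop :=
  filterdiff f (within D (locally t)) (fun s : R => scal s l).

Definition segment (T t : R) : Prop := 0 <= t <= T.

Definition Lip_half (T : R) (lambda : R -> R) : Prop :=
  exists K : R, forall s t, segment T s -> segment T t ->
    Rabs (lambda t - lambda s) <= K * sqrt (Rabs (t - s)).

Record simple_slit (T : R) (gamma : R -> C) : Prop := {
  slit_continuous : continuous_on (segment T) gamma;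
  slit_injective : forall s t, segment T s -> segment T t ->
    gamma s = gamma t -> s = t;
  slit_origin : gamma 0 = RtoC 0;
  slit_upper : forall t, 0 < t <= T -> upper_half (gamma t) }.

(* gamma ((0,t]) *)
Definition slit (gamma : R -> C) (t : R) (z : C) : Prop :=
  exists s, 0 < s <= t /\ gamma s = z.

(* The slit together with its reflection in the real axis and gamma 0. *)
Definition double_slit (gamma : R -> C) (t : R) (z : C) : Prop :=
  slit gamma t z \/ slit gamma t (Cconj z) \/ z = gamma 0.

Definition real_analytic_at (f : R -> R) (s0 : R) : Prop :=
  exists (a : nat -> R) (r : R), 0 < r /\
    forall s, Rabs (s - s0) < r -> is_pseries a (s - s0) (f s).

(* sigma t is the arc length of gamma ([0,t]) and S the total length; x + i y
   is the arc-length parametrization, continued to [-S,0] by reflection. *)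
Definition analytic_symmetric_slit (T : R) (gamma : R -> C) : Prop :=
  exists (S : R) (x y sigma : R -> R),
    0 < S /\
    (forall s, - S <= s <= S -> real_analytic_at x s /\ real_analytic_at y s) /\
    (forall s, - S <= s <= S -> x (- s) = x s /\ y (- s) = - y s) /\
    (forall s, - S <= s <= S -> (Derive x s) ^ 2 + (Derive y s) ^ 2 = 1) /\
    continuous_on (segment T) sigma /\
    (forall t1 t2, segment T t1 -> segment T t2 ->
       t1 < t2 -> sigma t1 < sigma t2) /\
    sigma 0 = 0 /\ sigma T = S /\
    (forall t, segment T t -> gamma t = (x (sigma t), y (sigma t))).

Record loewner_slit_maps (T : R) (lambda : R -> R) (gamma : R -> C)
    (h : C -> R -> C) : Prop := {
  loewner_conformal : forall t, segment T t ->
    conformal_onto (fun z => h z t) (setD upper_half (slit gamma t)) upper_half;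
  loewner_hydrodynamic : forall t, segment T t ->
    exists M rho : R, 0 < rho /\
      forall z, upper_half z -> ~ slit gamma t z -> rho < Cmod z ->
        Cmod (h z t - (z + 2 * t / z))%C <= M / (Cmod z) ^ 2;
  loewner_initial : forall z, upper_half z -> h z 0 = z;
  loewner_equation : forall z t, upper_half z -> segment T t ->
    ~ slit gamma t z ->
    @is_derive_within C_R_NormedModule (segment T) (fun s => h z s) t
      (2 / (h z t - lambda t))%C }.

(* A closed real interval as a subset of C. *)
Definition real_interval (u v : R) (w : C) : Prop := Im w = 0 /\ u <= Re w <= v.

(* Off the real axis, h _ t is also the Schwarz reflection of the slit map. The
   two prime ends of the slit domain at 0 are accessible along the positive and
   negative real half-axes, which are disjoint from the double slit; hp t and
   hm t are the boundary values of h _ t along these half-axes. *)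
Record reflected_slit_maps (T : R) (lambda : R -> R) (gamma : R -> C)
    (h : C -> R -> C) (hm hp : R -> R) : Prop := {
  reflected_lt : forall t, 0 < t <= T -> hm t < hp t;
  reflected_symmetric : forall z t, 0 < t <= T -> ~ double_slit gamma t z ->
    h (Cconj z) t = Cconj (h z t);
  reflected_conformal : forall t, 0 < t <= T ->
    conformal_onto (fun z => h z t)
      (setC (double_slit gamma t)) (setC (real_interval (hm t) (hp t)));
  right_prime_end : forall t, 0 < t <= T ->
    filterlim (fun x : R => h (RtoC x) t) (at_right 0) (locally (RtoC (hp t)));
  left_prime_end : forall t, 0 < t <= T ->
    filterlim (fun x : R => h (RtoC x) t) (at_left 0) (locally (RtoC (hm t)));
  right_singular_solution : forall t, 0 < t <= T ->
    @is_derive_within R_NormedModule (segment T) hp t (2 / (hp t - lambda t));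
  left_singular_solution : forall t, 0 < t <= T ->
    @is_derive_within R_NormedModule (segment T) hm t (2 / (hm t - lambda t));
  right_singular_initial : filterlim hp (at_right 0) (locally 0);
  left_singular_initial : filterlim hm (at_right 0) (locally 0) }.

(* Principal square root, cut along the negative real axis. *)
Definition Csqrt (w : C) : C :=
  (sqrt ((Cmod w + Re w) / 2),
   (if Rle_dec 0 (Im w) then 1 else -1) * sqrt ((Cmod w - Re w) / 2)).

Lemma Csqrt_sqr (w : C) : (Csqrt w * Csqrt w)%C = w.
Proof.
  destruct w as [u v].
  assert (Hm : Cmod (u, v) * Cmod (u, v) = u * u + v * v).
  { unfold Cmod; simpl; rewrite sqrt_sqrt; nra. }
  assert (H0 := Cmod_ge_0 (u, v)).
  set (m := Cmod (u, v)) in *.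
  assert (Hp : 0 <= (m + u) / 2) by nra.
  assert (Hq : 0 <= (m - u) / 2) by nra.
  assert (Hpq : sqrt ((m + u) / 2) * sqrt ((m - u) / 2) = Rabs v / 2).
  { rewrite <- sqrt_mult by assumption.
    replace ((m + u) / 2 * ((m - u) / 2)) with (Rsqr (v / 2))
      by (unfold Rsqr; nra).
    rewrite sqrt_Rsqr_abs; unfold Rdiv; rewrite Rabs_mult.
    rewrite (Rabs_pos_eq (/ 2)); lra. }
  assert (H1 := sqrt_sqrt _ Hp).
  assert (H2 := sqrt_sqrt _ Hq).
  unfold Csqrt, Cmult, Re, Im; fold m; simpl.
  destruct (Rle_dec 0 v) as [Hv|Hv].
  - rewrite (Rabs_pos_eq v Hv) in Hpq.
    apply injective_projections; simpl; nra.
  - rewrite (Rabs_left v) in Hpq by lra.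
    apply injective_projections; simpl; nra.
Qed.

Lemma Csqrt_Re_ge_0 (w : C) : 0 <= Re (Csqrt w).
Proof. apply sqrt_pos. Qed.

(* g w = b_1 (w - p)^(1/2) + b_2 (w - p)^(2/2) + ... for all w in V near p. *)
Definition half_power_expansion (g : C -> C) (V : C -> Prop) (p : R)
    (b : nat -> C) : Prop :=
  exists r : R, 0 < r /\
    forall w : C, V w -> Cmod (w - p)%C < r ->
      @is_series C_AbsRing C_NormedModule
        (fun k => (b (S k) * (Csqrt (w - p)) ^ (S k))%C) (g w).

(* Main.v *)
(* Put p = h^+(0,t), D = p - lambda(t) and F_t(zeta) = h^{-1}(p + zeta^2, t) =
   sum b_n(t) zeta^n.  The Loewner equation makes F_t(zeta) constant along
   zeta' = - zeta / (D (D + zeta^2)), so the b_n solve a triangular linear system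
   whose source terms are controlled by D ~ (b - c) sqrt t.  Going backwards from
   a fixed small time t0, the majorant K t^B s(t)^(n-1), with
   s(t) = 4 t^(-1/4) + const and B slightly below 1 / (b - c)^2, dominates the
   exact solution, and s(t) <= 8 t^(-1/4) for small t.  The constant 8 is universal
   only because b - c > 1/2: a smaller gap would make h(z,t0) - p decay faster than
   z^2 as z -> 0, against the half-power expansion at time t0.  No differentiability
   of b_n in t is needed: the solution of the system started from b_n(t0) sums to
   z along trajectories, hence coincides with b_n(t). *)

Require Import Defs.
From Stdlib Require Import Reals Lra Lia Psatz.
From Coquelicot Require Import Coquelicot.

Open Scope R_scope.

(** * The triangular coefficient system *)

(** Towards t = 0 the equation beta_n' = n beta_n / D^2 - e_(n-2) / D^3 damps its homogeneous part
    at rate n / D^2. One of these n units pays for the factor t^B of the majorant, because B / t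
    stays below 1 / D^2; the other n - 1 units pay for the source. This split keeps 1 / (b - c)^2 in
    the exponent free of n. Each step of two indices costs a factor of order 1 / D, which forces s^2
    D to be bounded below and so produces t^(-1/4). Identifying the solution with b_n needs points z
    whose trajectories stay, on a whole interval [tau, t0], where everything converges. They are the
    z with h(z,t0) - p = y (1 + i), y small: the sector 0 < Im <= Re is preserved backwards in time,
    Re zeta^2 >= 0 keeps D + zeta^2 away from 0, and a Gronwall estimate keeps zeta small. K and the
    constant in s(t) depend on the solution and must not enter A_n. K is absorbed once by a small
    power of t, the other constant inside the base of the power s^(n-1); hence delta can be chosen
    before n. *)

Lemma is_derive_cont (f : R -> R) (t l : R) : is_derive f t l -> continuous f t.
Proof.
  intros H; exact (ex_derive_continuous f t (ex_intro _ l H)).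
Qed.

Lemma is_derive_Rplus (f g : R -> R) (t a b : R) :
  is_derive f t a -> is_derive g t b -> is_derive (fun s => f s + g s) t (a + b).
Proof. intros H1 H2; exact (is_derive_plus f g t a b H1 H2). Qed.

Lemma is_derive_Rminus (f g : R -> R) (t a b : R) :
  is_derive f t a -> is_derive g t b -> is_derive (fun s => f s - g s) t (a - b).
Proof. intros H1 H2; exact (is_derive_minus f g t a b H1 H2). Qed.

Lemma is_derive_Rmult (f g : R -> R) (t a b : R) :
  is_derive f t a -> is_derive g t b ->
  is_derive (fun s => f s * g s) t (a * g t + f t * b).
Proof.
  intros H1 H2; exact (is_derive_mult f g t a b H1 H2 Rmult_comm).
Qed.

Lemma derive_le0_decreasing (f df : R -> R) (a b : R) :
  a <= b -> (forall x, a <= x <= b -> is_derive f x (df x)) ->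
  (forall x, a <= x <= b -> df x <= 0) -> f b <= f a.
Proof.
  intros Hab Hd Hneg.
  destruct (MVT_gen f a b df) as [x [Hx E]].
  - intros x Hx; rewrite Rmin_left, Rmax_right in Hx by lra; apply Hd; lra.
  - intros x Hx; rewrite Rmin_left, Rmax_right in Hx by lra.
    apply continuity_pt_filterlim.
    eapply is_derive_cont, Hd; lra.
  - rewrite Rmin_left, Rmax_right in Hx by lra.
    specialize (Hneg x Hx); nra.
Qed.

Lemma derive_bound_increment (f df : R -> R) (a b M : R) :
  a <= b -> (forall x, a <= x <= b -> is_derive f x (df x)) ->
  (forall x, a <= x <= b -> Rabs (df x) <= M) ->
  Rabs (f b - f a) <= M * (b - a).
Proof.
  intros Hab Hd HM.
  destruct (MVT_gen f a b df) as [x [Hx E]].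
  - intros x Hx; rewrite Rmin_left, Rmax_right in Hx by lra; apply Hd; lra.
  - intros x Hx; rewrite Rmin_left, Rmax_right in Hx by lra.
    apply continuity_pt_filterlim.
    eapply is_derive_cont, Hd; lra.
  - rewrite Rmin_left, Rmax_right in Hx by lra.
    rewrite E, Rabs_mult, (Rabs_pos_eq (b - a)) by lra.
    apply Rmult_le_compat_r; [lra | auto].
Qed.

Lemma is_derive_Rpower (a t : R) :
  0 < t -> is_derive (fun t => Rpower t a) t (a * Rpower t a / t).
Proof.
  intros Ht; unfold Rpower; auto_derive; [exact Ht | field; lra].
Qed.

(** * Backward comparison for scalar linear equations *)

Section LinearEquation.

Variable q : R -> R.
Hypothesis q_cont : forall t, continuous q t.
Variable t0 : R.

Definition primitive (f : R -> R) (t : R) : R := RInt f t0 t.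

Lemma is_derive_primitive (f : R -> R) (t : R) :
  (forall x, continuous f x) -> is_derive (primitive f) t (f t).
Proof.
  intros Hf; apply (is_derive_RInt f (primitive f) t0 t); [|apply Hf].
  apply filter_forall; intros x.
  apply (RInt_correct (V := R_CompleteNormedModule) f t0 x).
  apply (ex_RInt_continuous (V := R_CompleteNormedModule)); intros; apply Hf.
Qed.

(** Variation of constants, based at [t0] because the value is prescribed at the right end of the
    time interval. *)
Definition linear_solution (a : R) (g : R -> R) (t : R) : R :=
  exp (primitive q t) *
  (a + primitive (fun s => exp (- primitive q s) * g s) t).

Lemma linear_solution_derive (a : R) (g : R -> R) (t : R) :
  (forall x, continuous g x) ->
  is_derive (linear_solution a g) t (q t * linear_solution a g t + g t).
Proof.
  intros Hg; unfold linear_solution.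
  assert (Hq := fun x => is_derive_primitive q x q_cont).
  assert (Hqe : forall x, ex_derive (primitive q) x) by (intros x; exists (q x); auto).
  assert (He : forall x, continuous (fun s => exp (- primitive q s) * g s) x).
  { intros x; apply (continuous_mult (K := R_AbsRing)); [|apply Hg].
    apply is_derive_cont with (- q x * exp (- primitive q x)).
    auto_derive.
    - apply Hqe.
    - replace (Derive (fun x => primitive q x) x) with (q x) by
        (symmetry; apply is_derive_unique, Hq); simpl; ring. }
  assert (Hi := is_derive_primitive _ t He).
  set (J := primitive (fun s => exp (- primitive q s) * g s)) in *.
  auto_derive.
  - repeat split; [apply Hqe | eexists; exact Hi].
  - replace (Derive (fun x => primitive q x) t) with (q t) by
        (symmetry; apply is_derive_unique, Hq).
    replace (Derive (fun x => J x) t) with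
      (exp (- primitive q t) * g t) by (symmetry; apply is_derive_unique, Hi).
    rewrite exp_Ropp; field; apply Rgt_not_eq, exp_pos.
Qed.

Lemma linear_solution_init (a : R) (g : R -> R) : linear_solution a g t0 = a.
Proof.
  unfold linear_solution, primitive; rewrite !RInt_point.
  unfold zero; simpl; rewrite exp_0; ring.
Qed.

(** The integrating factor [exp (- primitive q)] makes [v] nonincreasing, so the sign at [t0] passes
    to all earlier times. *)
Lemma linear_subsolution_nonneg (v dv : R -> R) (tau : R) :
  tau <= t0 ->
  (forall t, tau <= t <= t0 -> is_derive v t (dv t)) ->
  (forall t, tau <= t <= t0 -> dv t <= q t * v t) ->
  0 <= v t0 ->
  forall t, tau <= t <= t0 -> 0 <= v t.
Proof.
  intros Htau Hd Hle H0 t Ht.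
  assert (Hq := fun x => is_derive_primitive q x q_cont).
  assert (Hqe : forall x, ex_derive (primitive q) x) by (intros x; exists (q x); auto).
  assert (HE : forall x, 0 < exp (- primitive q x)) by (intros; apply exp_pos).
  assert (M : exp (- primitive q t0) * v t0 <= exp (- primitive q t) * v t).
  { apply (derive_le0_decreasing (fun x => exp (- primitive q x) * v x)
      (fun x => exp (- primitive q x) * (dv x - q x * v x))); [lra| |].
    - intros x Hx; auto_derive.
      + repeat split; [apply Hqe | exists (dv x); apply Hd; lra].
      + replace (Derive (fun x => primitive q x) x) with (q x) by
          (symmetry; apply is_derive_unique, Hq).
        replace (Derive (fun x => v x) x) with (dv x) by
          (symmetry; apply is_derive_unique, Hd; lra).
        ring.
    - intros x Hx.
      specialize (Hle x ltac:(lra)); specialize (HE x); nra. }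
  assert (H1 := HE t0); assert (H2 := HE t).
  assert (0 <= exp (- primitive q t) * v t) by nra.
  destruct (Rle_lt_dec 0 (v t)); [assumption | nra].
Qed.

(** Both [u + y] and [u - y] are subsolutions, so [Rabs (y t)] never has to be differentiated. *)
Lemma linear_majorant (y f u du : R -> R) (tau : R) :
  tau <= t0 ->
  (forall t, tau <= t <= t0 -> is_derive y t (q t * y t + f t)) ->
  (forall t, tau <= t <= t0 -> is_derive u t (du t)) ->
  (forall t, tau <= t <= t0 -> du t + Rabs (f t) <= q t * u t) ->
  Rabs (y t0) <= u t0 ->
  forall t, tau <= t <= t0 -> Rabs (y t) <= u t.
Proof.
  intros Htau Hy Hu Hf H0 t Ht.
  apply Rabs_le_between in H0; apply Rabs_le_between; split.
  - cut (0 <= u t + y t); [lra|].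
    apply (linear_subsolution_nonneg (fun t => u t + y t)
      (fun t => du t + (q t * y t + f t)) tau); auto; [| |lra].
    + intros x Hx; apply is_derive_Rplus; auto.
    + intros x Hx; specialize (Hf x Hx).
      generalize (Rle_abs (f x)); nra.
  - cut (0 <= u t - y t); [lra|].
    apply (linear_subsolution_nonneg (fun t => u t - y t)
      (fun t => du t - (q t * y t + f t)) tau); auto; [| |lra].
    + intros x Hx; apply is_derive_Rminus; auto.
    + intros x Hx; specialize (Hf x Hx).
      generalize (Rle_abs (- f x)); rewrite Rabs_Ropp; nra.
Qed.

End LinearEquation.

(* Comparing coefficients in dF/dt = F' zeta / (D (D + zeta^2)), where
   F = sum beta_n zeta^n, gives D^2 beta_n' = e_n with this recurrence for e_n. *)
Record coefficient_flow (D : R -> R) (beta e : nat -> R -> R) : Prop := {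
  flow_derive : forall n t, is_derive (beta n) t (e n t / D t ^ 2);
  flow_beta0 : forall t, beta 0%nat t = 0;
  flow_e0 : forall t, e 0%nat t = 0;
  flow_e1 : forall t, e 1%nat t = beta 1%nat t;
  flow_rec : forall n t,
    e (S (S n)) t = INR (S (S n)) * beta (S (S n)) t - e n t / D t }.

Section Flow.

Variable D : R -> R.
Hypothesis D_cont : forall t, continuous D t.
Hypothesis D_pos : forall t, 0 < D t.
Variable t0 : R.
Variable a : nat -> R.

(** Eliminating e_n gives beta_n' = n beta_n / D^2 - e_(n-2) / D^3; [g] stands for e_(n-2). *)
Definition flow_next (n : nat) (g : R -> R) : R -> R :=
  linear_solution (fun t => INR n / D t ^ 2) t0 (a n) (fun t => - g t / D t ^ 3).

(** The pair is (e_n, e_(n+1)): the recurrence reaches back two indices, and carrying two neighbours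
    makes the recursion structural. *)
Fixpoint flow_pair (n : nat) : (R -> R) * (R -> R) :=
  match n with
  | O => (fun _ => 0, flow_next 1 (fun _ => 0))
  | S m =>
      let g := fst (flow_pair m) in
      (snd (flow_pair m),
       fun t => INR (S (S m)) * flow_next (S (S m)) g t - g t / D t)
  end.

Definition flow_e (n : nat) : R -> R := fst (flow_pair n).

Definition flow_beta (n : nat) : R -> R :=
  match n with
  | O => fun _ => 0
  | S O => flow_next 1 (fun _ => 0)
  | S (S m) => flow_next (S (S m)) (flow_e m)
  end.

Lemma continuous_div_pow (g : R -> R) (k : nat) (t : R) :
  (forall x, continuous g x) -> continuous (fun t => g t / D t ^ k) t.
Proof.
  intros Hg; apply (continuous_mult (K := R_AbsRing)); [apply Hg|].
  apply continuous_comp; [|apply continuous_Rinv, pow_nonzero, Rgt_not_eq, D_pos].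
  induction k as [|k IH]; simpl.
  - apply continuous_const.
  - apply (continuous_mult (K := R_AbsRing)); auto.
Qed.

Lemma flow_next_derive (n : nat) (g : R -> R) (t : R) :
  (forall x, continuous g x) ->
  is_derive (flow_next n g) t
    (INR n / D t ^ 2 * flow_next n g t + - g t / D t ^ 3).
Proof.
  intros Hg.
  refine (linear_solution_derive (fun t => INR n / D t ^ 2) _ t0 (a n)
    (fun t => - g t / D t ^ 3) t _).
  - intros; apply continuous_div_pow; intros; apply continuous_const.
  - intros x; apply continuous_div_pow.
    intros y; exact (continuous_opp g y (Hg y)).
Qed.

Lemma flow_pair_continuous (n : nat) :
  (forall x, continuous (fst (flow_pair n)) x) /\
  (forall x, continuous (snd (flow_pair n)) x).
Proof.
  induction n as [|n [IH1 IH2]]; simpl; split; auto; intros x.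
  - apply continuous_const.
  - eapply is_derive_cont, flow_next_derive; intros; apply continuous_const.
  - apply (continuous_minus (V := R_NormedModule)).
    + apply (continuous_mult (K := R_AbsRing)); [apply continuous_const|].
      eapply is_derive_cont, flow_next_derive, IH1.
    + apply continuous_ext with (fun t => fst (flow_pair n) t / D t ^ 1).
      * intros y; rewrite pow_1; reflexivity.
      * apply continuous_div_pow, IH1.
Qed.

Lemma flow_solves : coefficient_flow D flow_beta flow_e.
Proof.
  assert (Hrec : forall n t, flow_e (S (S n)) t =
    INR (S (S n)) * flow_beta (S (S n)) t - flow_e n t / D t) by reflexivity.
  assert (HD := fun t => Rgt_not_eq _ _ (D_pos t)).
  split; try reflexivity.
  intros n t; destruct n as [|[|n]].
  - unfold flow_e, flow_beta; simpl.
    evar_last; [apply (is_derive_const (V := R_NormedModule)) |].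
    unfold zero; simpl; field; apply HD.
  - evar_last; [apply flow_next_derive; intros; apply continuous_const |].
    unfold flow_e; simpl; field; apply HD.
  - evar_last; [apply flow_next_derive, (flow_pair_continuous n) |].
    rewrite Hrec; fold (flow_e n).
    change (flow_beta (S (S n)) t) with (flow_next (S (S n)) (flow_e n) t).
    field; apply HD.
Qed.

Lemma flow_init (n : nat) : a 0%nat = 0 -> flow_beta n t0 = a n.
Proof.
  intros H; destruct n as [|[|n]]; [exact (eq_sym H)| |];
    unfold flow_beta, flow_next; apply linear_solution_init.
Qed.

End Flow.

(** [k] bounds the logarithmic growth rate of [u] and lies between 1 / (4 D^2) and 1 / D^2. At index
    n + 1 the damping (n + 1) / D^2 covers k for [u] and n k for the source; a nonincreasing [s]
    only helps. In the bound for [e], 5 / 4 = 1 + 1 / 4 adds the shares of (n + 1) beta and of the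
    source, and 5 <= s^2 D turns 5 / 4 back into the 1 / 4 required two indices later. *)
Lemma flow_majorant (D u du s ds k : R -> R) (beta e : nat -> R -> R)
    (tau t0 : R) :
  (forall t, continuous D t) -> (forall t, 0 < D t) ->
  coefficient_flow D beta e ->
  tau <= t0 ->
  (forall t, tau <= t <= t0 ->
     is_derive u t (du t) /\ is_derive s t (ds t) /\
     0 <= u t /\ 0 < s t /\ ds t <= 0 /\ du t <= k t * u t /\
     k t * D t ^ 2 <= 1 <= 4 * k t * D t ^ 2 /\ 5 <= s t ^ 2 * D t) ->
  (forall n, Rabs (beta (S n) t0) <= u t0 * s t0 ^ n) ->
  forall n t, tau <= t <= t0 ->
    Rabs (beta (S n) t) <= u t * s t ^ n /\
    Rabs (e (S n) t) <= 5 / 4 * INR (S n) * (u t * s t ^ n).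
Proof.
  intros HDc HDp [Hd H0 He0 He1 Hrec] Htau Hyp Hinit.
  assert (HqC : forall n t, continuous (fun t => INR n / D t ^ 2) t).
  { intros n t; apply (continuous_div_pow D HDc HDp (fun _ => INR n) 2).
    intros; apply continuous_const. }
  (* Treats the single index n + 1, with [g] in the role of e_(n-1): the zero function for the first
     two indices, an already bounded rate afterwards. *)
  assert (Hstep : forall n (g : R -> R),
    (forall t, tau <= t <= t0 ->
       e (S n) t = INR (S n) * beta (S n) t - g t / D t) ->
    (forall t, tau <= t <= t0 ->
       Rabs (g t) <= INR n / 4 * D t * (u t * s t ^ n)) ->
    forall t, tau <= t <= t0 ->
    Rabs (beta (S n) t) <= u t * s t ^ n /\
    Rabs (e (S n) t) <= 5 / 4 * INR (S n) * (u t * s t ^ n)).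
  { intros n g Hg Hgb.
    assert (HB : forall t, tau <= t <= t0 ->
      Rabs (beta (S n) t) <= u t * s t ^ n).
    { apply (linear_majorant (fun t => INR (S n) / D t ^ 2) (HqC (S n)) t0
        (beta (S n)) (fun t => - g t / D t ^ 3)
        (fun t => u t * s t ^ n)
        (fun t => du t * s t ^ n +
           u t * (INR n * ds t * s t ^ pred n)) tau Htau).
      - intros t Ht; evar_last; [apply Hd|].
        rewrite Hg by assumption; field; apply Rgt_not_eq, HDp.
      - intros t Ht; destruct (Hyp t Ht) as (Hu & Hs & _).
        evar_last.
        + apply (is_derive_Rmult u (fun t => s t ^ n));
            [exact Hu | apply is_derive_pow, Hs].
        + ring.
      - intros t Ht; destruct (Hyp t Ht) as (_ & _ & Hu & Hs & Hds & Hdu & Hk & _).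
        specialize (Hgb t Ht); specialize (HDp t).
        assert (Hsn : 0 < s t ^ n) by (apply pow_lt; auto).
        assert (Hspn : 0 < s t ^ pred n) by (apply pow_lt; auto).
        assert (Hn := pos_INR n).
        assert (HD2 : 0 < D t ^ 2) by (apply pow_lt; auto).
        assert (HD3 : 0 < D t ^ 3) by (apply pow_lt; auto).
        replace (Rabs (- g t / D t ^ 3)) with (Rabs (g t) / D t ^ 3).
        2:{ unfold Rdiv; rewrite Rabs_mult, Rabs_Ropp, (Rabs_pos_eq (/ _)); auto.
            left; apply Rinv_0_lt_compat; auto. }
        assert (E1 : Rabs (g t) / D t ^ 3 <=
          INR n * k t * (u t * s t ^ n)).
        { apply Rle_div_l; [auto|]. eapply Rle_trans; [exact Hgb|].
          replace (INR n * k t * (u t * s t ^ n) * D t ^ 3) with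
            ((INR n / 4 * D t * (u t * s t ^ n)) * (4 * k t * D t ^ 2))
            by (simpl; field).
          rewrite <- (Rmult_1_r (INR n / 4 * D t * (u t * s t ^ n))) at 1.
          apply Rmult_le_compat_l; [|lra].
          repeat apply Rmult_le_pos; lra. }
        assert (E2 : u t * (INR n * ds t * s t ^ pred n) <= 0).
        { assert (0 <= u t * (INR n * - ds t * s t ^ pred n)); [|lra].
          repeat apply Rmult_le_pos; lra. }
        assert (E3 : du t * s t ^ n <= k t * (u t * s t ^ n)) by nra.
        assert (E4 : k t * INR (S n) * (u t * s t ^ n) <=
                     INR (S n) / D t ^ 2 * (u t * s t ^ n)).
        { apply Rmult_le_compat_r; [apply Rmult_le_pos; lra|].
          apply (Rle_div_r (k t * INR (S n)) (INR (S n)) (D t ^ 2)); [auto|].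
          assert (H1 := pos_INR (S n)).
          replace (k t * INR (S n) * D t ^ 2) with (INR (S n) * (k t * D t ^ 2)) by ring.
          rewrite <- (Rmult_1_r (INR (S n))) at 2.
          apply Rmult_le_compat_l; lra. }
        rewrite S_INR in E4 |- *; lra.
      - apply Hinit. }
    intros t Ht; split; [auto|].
    specialize (HB t Ht); specialize (Hgb t Ht); rewrite Hg by assumption.
    assert (HDt := HDp t).
    eapply Rle_trans; [apply Rabs_triang|].
    rewrite Rabs_Ropp; unfold Rdiv at 1.
    rewrite !Rabs_mult, (Rabs_pos_eq (/ _)), (Rabs_pos_eq (INR (S n)))
      by (try apply pos_INR; left; apply Rinv_0_lt_compat; auto).
    assert (E1 : Rabs (g t) * / D t <= INR n / 4 * (u t * s t ^ n)).
    { apply (Rle_div_l (Rabs (g t))); [auto|]. lra. }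
    assert (HU : 0 <= u t * s t ^ n).
    { eapply Rle_trans; [apply Rabs_pos | exact HB]. }
    assert (Hn := pos_INR n); rewrite S_INR in *. nra. }
  (* Two consecutive indices are carried, because the source for an index is the rate two indices
     below. *)
  match goal with |- forall n, @?P n =>
    cut (forall n, P n /\ P (S n)); [intros H n; apply H|] end.
  intros n; induction n as [|n [IH IH']]; split; try assumption.
  - apply (Hstep 0%nat (fun _ => 0)).
    + intros t _; rewrite He1; simpl; unfold Rdiv; ring.
    + intros t _; rewrite Rabs_R0; simpl; lra.
  - apply (Hstep 1%nat (fun _ => 0)).
    + intros t _; rewrite Hrec, He0; simpl; unfold Rdiv; ring.
    + intros t Ht; destruct (Hyp t Ht) as (_ & _ & Hu & Hs & _).
      rewrite Rabs_R0. repeat apply Rmult_le_pos; simpl; try lra.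
      left; apply HDp.
  - intros t Ht.
    apply (Hstep (S (S n)) (e (S n))); [intros; apply Hrec| | exact Ht].
    clear t Ht; intros t Ht; destruct (Hyp t Ht) as (_ & _ & Hu & Hs & _ & _ & _ & Hx).
    destruct (IH t Ht) as [_ He]; eapply Rle_trans; [exact He|].
    assert (Hsn : 0 < s t ^ n) by (apply pow_lt; auto).
    assert (HU : 0 <= u t * s t ^ n) by (apply Rmult_le_pos; lra).
    replace (INR (S (S n)) / 4 * D t * (u t * s t ^ S (S n))) with
      (INR (S (S n)) / 4 * (u t * s t ^ n) * (s t ^ 2 * D t)) by (simpl; field).
    assert (Hn := pos_INR (S n)); rewrite (S_INR (S n)).
    assert (0 <= (INR (S n) + 1) / 4 * (u t * s t ^ n)) by nra.
    assert (0 <= INR (S n) * (u t * s t ^ n)) by nra.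
    nra.
Qed.

(** * Power series along the flow *)

(** Sums the first [n] terms, one fewer than [sum_n], so that the empty sum is available to start
    inductions and telescoping. *)
Fixpoint csum (c : nat -> C) (n : nat) : C :=
  match n with O => RtoC 0 | S m => (csum c m + c m)%C end.

Definition clim (u : nat -> C) (l : C) : Prop :=
  forall eps, 0 < eps -> exists N, forall n, (N <= n)%nat -> Cmod (u n - l)%C < eps.

Lemma csum_ext (a b : nat -> C) (n : nat) :
  (forall k, a k = b k) -> csum a n = csum b n.
Proof. intros H; induction n; simpl; [|rewrite IHn, H]; reflexivity. Qed.

Lemma csum_minus (a b : nat -> C) (n : nat) :
  csum (fun k => a k - b k)%C n = (csum a n - csum b n)%C.
Proof. induction n as [|n IH]; simpl; [|rewrite IH]; ring. Qed.

Lemma sum_n_csum (c : nat -> C) (n : nat) :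
  sum_n (G := C_AbelianMonoid) c n = csum c (S n).
Proof.
  induction n as [|n IH].
  - rewrite sum_O; simpl; ring.
  - rewrite sum_Sn, IH; reflexivity.
Qed.

Lemma is_series_clim (c : nat -> C) (l : C) :
  @is_series C_AbsRing C_NormedModule c l -> clim (csum c) l.
Proof.
  intros H eps Heps.
  destruct (proj1 (filterlim_locally_ball_norm (U := C_NormedModule) _ l) H
    (mkposreal eps Heps)) as [N HN].
  exists (S N); intros n Hn; destruct n as [|n]; [lia|].
  specialize (HN n ltac:(lia)).
  rewrite <- sum_n_csum; exact HN.
Qed.

Lemma clim_minus (u v : nat -> C) (k l : C) :
  clim u k -> clim v l -> clim (fun n => u n - v n)%C (k - l)%C.
Proof.
  intros Hu Hv eps Heps.
  destruct (Hu (eps / 2) ltac:(lra)) as [N1 H1].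
  destruct (Hv (eps / 2) ltac:(lra)) as [N2 H2].
  exists (N1 + N2)%nat; intros n Hn.
  specialize (H1 n ltac:(lia)); specialize (H2 n ltac:(lia)).
  replace (u n - v n - (k - l))%C with ((u n - k) + - (v n - l))%C by ring.
  eapply Rle_lt_trans; [apply Cmod_triangle|]; rewrite Cmod_opp; lra.
Qed.

Lemma clim_ext (u v : nat -> C) (l : C) :
  (forall n, u n = v n) -> clim u l -> clim v l.
Proof.
  intros E H eps Heps; destruct (H eps Heps) as [N HN].
  exists N; intros n Hn; rewrite <- E; auto.
Qed.

Lemma clim_of_bound (u : nat -> C) (l : C) (e : nat -> R) :
  (forall n, Cmod (u n - l)%C <= e n) -> is_lim_seq e 0 -> clim u l.
Proof.
  intros H Hl eps Heps.
  destruct (proj2 (is_lim_seq_spec e 0) Hl (mkposreal eps Heps)) as [N HN].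
  exists N; intros n Hn; specialize (HN n Hn); simpl in HN.
  rewrite Rminus_0_r in HN.
  eapply Rle_lt_trans; [apply H|]; eapply Rle_lt_trans; [apply Rle_abs|exact HN].
Qed.

Lemma clim_series_terms_bounded (c : nat -> C) (l : C) :
  clim (csum c) l -> exists K, 0 <= K /\ forall n, Cmod (c n) <= K.
Proof.
  intros H; destruct (H 1 Rlt_0_1) as [N HN].
  assert (Hf : exists K, 0 <= K /\ forall n, (n < N)%nat -> Cmod (c n) <= K).
  { clear; induction N as [|N [K [H0 HK]]].
    - exists 0; split; [lra | intros; lia].
    - exists (K + Cmod (c N)); assert (H1 := Cmod_ge_0 (c N)).
      split; [lra|]; intros n Hn.
      destruct (Nat.eq_dec n N) as [->|]; [lra|].
      specialize (HK n ltac:(lia)); lra. }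
  destruct Hf as [K [H0 HK]]; exists (K + 2); split; [lra|]; intros n.
  destruct (Nat.lt_ge_cases n N) as [Hn|Hn]; [specialize (HK n Hn); lra|].
  assert (H1 := HN n Hn); assert (H2 := HN (S n) ltac:(lia)).
  replace (c n) with ((csum c (S n) - l) + - (csum c n - l))%C by (simpl; ring).
  eapply Rle_trans; [apply Cmod_triangle|]; rewrite Cmod_opp; lra.
Qed.

(** The terms of a convergent series are bounded, so one nonzero point of convergence suffices, with
    r = 1 / |z|. Dividing K by |z| accounts for the exponent [S k]. *)
Lemma power_series_coef_bound (d : nat -> C) (z l : C) :
  z <> RtoC 0 -> clim (csum (fun k => d k * z ^ S k)%C) l ->
  exists K r, 0 <= K /\ 0 < r /\ forall n, Cmod (d n) <= K * r ^ n.
Proof.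
  intros Hz H; destruct (clim_series_terms_bounded _ _ H) as [K [H0 HK]].
  apply Cmod_gt_0 in Hz.
  exists (K / Cmod z), (/ Cmod z).
  split; [apply Rdiv_le_0_compat; lra|].
  split; [apply Rinv_0_lt_compat; lra|].
  intros n; specialize (HK n); rewrite Cmod_mult, Cmod_pow in HK; simpl in HK.
  rewrite pow_inv.
  assert (Hzn : 0 < Cmod z ^ n) by (apply pow_lt; auto).
  replace (K / Cmod z * / Cmod z ^ n) with (K / (Cmod z * Cmod z ^ n))
    by (field; split; lra).
  apply Rle_div_r; [apply Rmult_lt_0_compat; auto | exact HK].
Qed.

(** Identity theorem: at a sufficiently small zero of the sum, the first nonvanishing term would
    outweigh the whole tail. Zeros are required only at some arbitrarily small nonzero arguments,
    which is all that the trajectories provide. *)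
Lemma power_series_unique (d : nat -> C) (K r : R) :
  0 <= K -> 0 < r -> (forall n, Cmod (d n) <= K * r ^ n) ->
  (forall eta, 0 < eta -> exists z, z <> RtoC 0 /\ Cmod z < eta /\
     clim (csum (fun k => d k * z ^ S k)%C) (RtoC 0)) ->
  forall k, d k = RtoC 0.
Proof.
  intros HK Hr Hd Hz k; induction k as [k IH] using Wf_nat.lt_wf_ind.
  destruct (Ceq_dec (d k) (RtoC 0)) as [|Hne]; [assumption|exfalso].
  apply Cmod_gt_0 in Hne; set (del := Cmod (d k)) in *.
  remember (K * r ^ S k) as M eqn:EM.
  assert (HM : 0 <= M) by (rewrite EM; apply Rmult_le_pos; [|apply pow_le]; lra).
  (* The first bound gives the tail a geometric ratio 1 / 2, so that it is at most 2 M x x^(k+1);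
     the second makes this less than half of the leading term del x^(k+1). *)
  destruct (Hz (Rmin (/ (2 * r)) (del / (4 * (M + 1))))) as [z [Hz0 [Hzb Hl]]].
  { apply Rmin_pos; [apply Rinv_0_lt_compat; lra | apply Rdiv_lt_0_compat; lra]. }
  apply Cmod_gt_0 in Hz0; set (x := Cmod z) in *.
  assert (Hx1 : r * x <= 1 / 2).
  { assert (x < / (2 * r)) by (eapply Rlt_le_trans; [exact Hzb | apply Rmin_l]).
    replace (1 / 2) with (r * / (2 * r)) by (field; lra).
    apply Rmult_le_compat_l; lra. }
  assert (Hx2 : 4 * (M + 1) * x < del).
  { assert (x < del / (4 * (M + 1)))
      by (eapply Rlt_le_trans; [exact Hzb | apply Rmin_r]).
    replace del with (4 * (M + 1) * (del / (4 * (M + 1)))) by (field; lra).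
    apply Rmult_lt_compat_l; lra. }
  assert (Hpre : forall n, (n <= k)%nat ->
    csum (fun k => d k * z ^ S k)%C n = RtoC 0).
  { induction n as [|n IHn]; intros Hn; [reflexivity|].
    change (csum (fun k => d k * z ^ S k)%C n + d n * z ^ S n = RtoC 0)%C.
    rewrite IHn by lia. rewrite (IH n) by lia; ring. }
  assert (Hxk : 0 < x ^ S k) by (apply pow_lt; auto).
  assert (HMx : 0 <= M * x * x ^ S k)
    by (apply Rmult_le_pos; [apply Rmult_le_pos|]; lra).
  assert (Htail : forall m,
    Cmod (csum (fun k => d k * z ^ S k)%C (S k + m) - d k * z ^ S k)%C
    <= M * x * x ^ S k * (2 - 2 * (1 / 2) ^ m)).
  { induction m as [|m IHm].
    - rewrite Nat.add_0_r.
      change (Cmod (csum (fun k => d k * z ^ S k) k + d k * z ^ S k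
        - d k * z ^ S k)%C <= M * x * x ^ S k * (2 - 2 * (1 / 2) ^ 0)).
      rewrite Hpre by lia.
      replace (RtoC 0 + d k * z ^ S k - d k * z ^ S k)%C with (RtoC 0) by ring.
      rewrite Cmod_0; simpl; lra.
    - rewrite Nat.add_succ_r.
      change (Cmod (csum (fun k => d k * z ^ S k) (S k + m)
        + d (S k + m)%nat * z ^ S (S k + m) - d k * z ^ S k)%C
        <= M * x * x ^ S k * (2 - 2 * (1 / 2) ^ S m)).
      match goal with |- Cmod (?A + ?B - ?E)%C <= _ =>
        replace (A + B - E)%C with ((A - E) + B)%C by ring end.
      eapply Rle_trans; [apply Cmod_triangle|].
      rewrite Cmod_mult, Cmod_pow; fold x.
      assert (Hb : Cmod (d (S k + m)%nat) * x ^ S (S k + m) <=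
        M * x * x ^ S k * (1 / 2) ^ m).
      { eapply Rle_trans.
        - apply Rmult_le_compat_r; [apply pow_le; lra | apply Hd].
        - replace (K * r ^ (S k + m) * x ^ S (S k + m)) with
            (M * x * x ^ S k * (r * x) ^ m).
          + apply Rmult_le_compat_l; [exact HMx|].
            apply pow_incr; split; [apply Rmult_le_pos; lra | lra].
          + rewrite EM, Rpow_mult_distr.
            replace (S (S k + m)) with (S k + m + 1)%nat by lia.
            rewrite !pow_add; simpl; ring. }
      assert (E : (1 / 2) ^ S m = (1 / 2) ^ m / 2) by (simpl; field).
      rewrite E; lra. }
  destruct (Hl (del * x ^ S k / 2)) as [N HN].
  { apply Rdiv_lt_0_compat; [apply Rmult_lt_0_compat; auto|lra]. }
  specialize (HN (S k + N)%nat ltac:(lia)); specialize (Htail N).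
  assert (Hlow : del * x ^ S k <=
    Cmod (csum (fun k => d k * z ^ S k)%C (S k + N) - RtoC 0)%C +
    Cmod (csum (fun k => d k * z ^ S k)%C (S k + N) - d k * z ^ S k)%C).
  { unfold del, x; rewrite <- Cmod_pow, <- Cmod_mult.
    set (A := csum _ _) in *.
    replace (d k * z ^ S k)%C with ((A - RtoC 0) + - (A - d k * z ^ S k))%C at 1
      by ring.
    eapply Rle_trans; [apply Cmod_triangle|]; rewrite Cmod_opp; lra. }
  assert (Hh : 0 < (1 / 2) ^ N) by (apply pow_lt; lra).
  assert (del * x ^ S k / 2 <= M * x * x ^ S k * 2) by nra.
  assert (4 * (M + 1) * x * x ^ S k < del * x ^ S k)
    by (apply Rmult_lt_compat_r; lra).
  assert (0 < x * x ^ S k) by (apply Rmult_lt_0_compat; lra).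
  lra.
Qed.

(** * Differentiation of complex-valued curves *)

Definition cderive (f : R -> C) (t : R) (l : C) : Prop :=
  is_derive (fun s => Re (f s)) t (Re l) /\ is_derive (fun s => Im (f s)) t (Im l).

Lemma cderive_const (c : C) (t : R) : cderive (fun _ => c) t (RtoC 0).
Proof. split; apply (is_derive_const (V := R_NormedModule)). Qed.

Lemma cderive_plus (f g : R -> C) (t : R) (a b : C) :
  cderive f t a -> cderive g t b -> cderive (fun s => f s + g s)%C t (a + b)%C.
Proof.
  intros [H1 H2] [H3 H4]; split.
  - exact (is_derive_Rplus _ _ _ _ _ H1 H3).
  - exact (is_derive_Rplus _ _ _ _ _ H2 H4).
Qed.

Lemma cderive_mult (f g : R -> C) (t : R) (a b : C) :
  cderive f t a -> cderive g t b ->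
  cderive (fun s => f s * g s)%C t (a * g t + f t * b)%C.
Proof.
  intros [H1 H2] [H3 H4]; split.
  - evar_last.
    + exact (is_derive_Rminus _ _ _ _ _ (is_derive_Rmult _ _ _ _ _ H1 H3)
        (is_derive_Rmult _ _ _ _ _ H2 H4)).
    + simpl; unfold Re, Im; ring.
  - evar_last.
    + exact (is_derive_Rplus _ _ _ _ _ (is_derive_Rmult _ _ _ _ _ H1 H4)
        (is_derive_Rmult _ _ _ _ _ H2 H3)).
    + simpl; unfold Re, Im; ring.
Qed.

(** The logarithmic form f' = f L suits the equation for zeta and yields a rule for powers without
    predecessor exponents. *)
Lemma cderive_pow_log (f : R -> C) (t : R) (L : C) (n : nat) :
  cderive f t (f t * L)%C ->
  cderive (fun s => f s ^ n)%C t (INR n * L * f t ^ n)%C.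
Proof.
  intros H; induction n as [|n IH].
  - replace (INR 0 * L * f t ^ 0)%C with (RtoC 0) by (simpl; ring).
    exact (cderive_const (RtoC 1) t).
  - replace (INR (S n) * L * f t ^ S n)%C with
      ((f t * L) * f t ^ n + f t * (INR n * L * f t ^ n))%C.
    + apply (cderive_mult f (fun s => f s ^ n)%C); assumption.
    + rewrite S_INR, RtoC_plus, Cpow_S; ring.
Qed.

Lemma Cmod_pair_le (a b : R) : Cmod (a, b) <= Rabs a + Rabs b.
Proof.
  replace (a, b) with (RtoC a + Ci * RtoC b)%C
    by (apply injective_projections; simpl; ring).
  eapply Rle_trans; [apply Cmod_triangle|].
  rewrite Cmod_mult, !Cmod_R.
  replace (Cmod Ci) with 1; [lra|].
  unfold Cmod, Ci; simpl; replace (0 * (0 * 1) + 1 * (1 * 1)) with 1 by ring.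
  symmetry; apply sqrt_1.
Qed.

(** The mean value theorem fails for complex values; applying it to the real and imaginary parts
    separately costs the factor 2. *)
Lemma cderive_bound_increment (f df : R -> C) (a b M : R) :
  a <= b -> (forall t, a <= t <= b -> cderive f t (df t)) ->
  (forall t, a <= t <= b -> Cmod (df t) <= M) ->
  Cmod (f b - f a)%C <= 2 * (M * (b - a)).
Proof.
  intros Hab Hd HM.
  assert (H1 : Rabs (Re (f b) - Re (f a)) <= M * (b - a)).
  { apply (derive_bound_increment (fun s => Re (f s)) (fun s => Re (df s)));
      [assumption | intros; apply Hd; auto |].
    intros x Hx; eapply Rle_trans; [apply re_le_Cmod | exact (HM x Hx)]. }
  assert (H2 : Rabs (Im (f b) - Im (f a)) <= M * (b - a)).
  { apply (derive_bound_increment (fun s => Im (f s)) (fun s => Im (df s)));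
      [assumption | intros; apply Hd; auto |].
    intros x Hx; apply Rle_trans with (Cmod (df x)); [|exact (HM x Hx)].
    eapply Rle_trans; [apply Rmax_r | apply (Rmax_Cmod (df x))]. }
  replace (f b - f a)%C with (Re (f b) - Re (f a), Im (f b) - Im (f a)).
  - eapply Rle_trans; [apply Cmod_pair_le|]; lra.
  - destruct (f a), (f b); apply injective_projections; simpl; ring.
Qed.

(** * Conservation of the series along a trajectory *)

Section FlowTransport.

Variables (D u s : R -> R) (br er bi ei : nat -> R -> R) (zeta : R -> C).
Variables (tau t0 : R).

Definition flow_coef (n : nat) (t : R) : C := (br n t, bi n t).
Definition flow_rate (n : nat) (t : R) : C := (er n t, ei n t).

Hypothesis flow_r : coefficient_flow D br er.
Hypothesis flow_i : coefficient_flow D bi ei.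
Hypothesis D_pos : forall t, 0 < D t.

(** Puts all indices into one formula: at n = 0 the convention [pred 0 = 0] is harmless because e_0
    vanishes. *)
Lemma flow_rate_rec (n : nat) (t : R) :
  (RtoC (INR (S n)) * flow_coef (S n) t = flow_rate (S n) t + flow_rate (pred n) t / D t)%C.
Proof.
  assert (HD := Rgt_not_eq _ _ (D_pos t)).
  replace (flow_rate (pred n) t / D t)%C with
    (er (pred n) t / D t, ei (pred n) t / D t)
    by (unfold flow_rate; apply injective_projections; simpl; field; exact HD).
  destruct n as [|n]; apply injective_projections; simpl pred; unfold flow_coef, flow_rate.
  - change (INR 1 * br 1%nat t - 0 * bi 1%nat t = er 1%nat t + er 0%nat t / D t).
    rewrite (flow_e1 _ _ _ flow_r), (flow_e0 _ _ _ flow_r); simpl; field; exact HD.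
  - change (INR 1 * bi 1%nat t + 0 * br 1%nat t = ei 1%nat t + ei 0%nat t / D t).
    rewrite (flow_e1 _ _ _ flow_i), (flow_e0 _ _ _ flow_i); simpl; field; exact HD.
  - change (INR (S (S n)) * br (S (S n)) t - 0 * bi (S (S n)) t =
      er (S (S n)) t + er n t / D t).
    rewrite (flow_rec _ _ _ flow_r); field; exact HD.
  - change (INR (S (S n)) * bi (S (S n)) t + 0 * br (S (S n)) t =
      ei (S (S n)) t + ei n t / D t).
    rewrite (flow_rec _ _ _ flow_i); field; exact HD.
Qed.

Definition flow_sum (N : nat) (t : R) : C :=
  csum (fun k => flow_coef (S k) t * zeta t ^ S k)%C N.

Lemma flow_coef_derive (n : nat) (t : R) : cderive (flow_coef n) t (flow_rate n t / D t ^ 2)%C.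
Proof.
  assert (HD := Rgt_not_eq _ _ (D_pos t)).
  replace (flow_rate n t / D t ^ 2)%C with (er n t / D t ^ 2, ei n t / D t ^ 2).
  - split; [apply (flow_derive _ _ _ flow_r) | apply (flow_derive _ _ _ flow_i)].
  - rewrite <- RtoC_pow; unfold flow_rate; apply injective_projections; simpl; field; lra.
Qed.

(** Substituting k beta_k = e_k + e_(k-2) / D, the k-th term contributes (e_k zeta^(k+2) - e_(k-2)
    zeta^k) / (D^2 (D + zeta^2)). The sum telescopes and only the two top terms survive. *)
Lemma flow_sum_derive (N : nat) (t : R) :
  (D t + zeta t ^ 2 <> RtoC 0)%C ->
  cderive zeta t (zeta t * (- / (D t * (D t + zeta t ^ 2))))%C ->
  cderive (flow_sum N) t
    ((zeta t ^ (2 + N) * flow_rate N t + zeta t ^ S N * flow_rate (pred N) t)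
     / (D t ^ 2 * (D t + zeta t ^ 2)))%C.
Proof.
  intros Hne Hz.
  assert (HD : RtoC (D t) <> RtoC 0).
  { intros H; apply (Rgt_not_eq _ _ (D_pos t)), RtoC_inj, H. }
  induction N as [|N IH].
  - replace (flow_rate 0 t) with (RtoC 0).
    + match goal with |- cderive _ _ ?l => replace l with (RtoC 0) end.
      * exact (cderive_const (RtoC 0) t).
      * simpl pred; replace (flow_rate 0 t) with (RtoC 0).
        -- field; split; assumption.
        -- unfold flow_rate; rewrite (flow_e0 _ _ _ flow_r), (flow_e0 _ _ _ flow_i);
             reflexivity.
    + unfold flow_rate; rewrite (flow_e0 _ _ _ flow_r), (flow_e0 _ _ _ flow_i);
        reflexivity.
  - assert (H := cderive_plus _ _ _ _ _ IH (cderive_mult (flow_coef (S N))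
      (fun s => zeta s ^ S N)%C _ _ _ (flow_coef_derive (S N) t)
      (cderive_pow_log _ _ _ (S N) Hz))).
    match type of H with cderive _ _ ?k =>
      match goal with |- cderive _ _ ?l => replace l with k; [exact H|] end end.
    replace (flow_coef (S N) t * (INR (S N) * - / (D t * (D t + zeta t ^ 2)) *
      zeta t ^ S N))%C with ((INR (S N) * flow_coef (S N) t) *
        (- / (D t * (D t + zeta t ^ 2)) * zeta t ^ S N))%C by ring.
    rewrite flow_rate_rec; simpl pred.
    replace (2 + S N)%nat with (S (S (S N))) by lia.
    replace (2 + N)%nat with (S (S N)) by lia.
    rewrite !Cpow_S.
    change (zeta t ^ 0)%C with (RtoC 1) in *; change (D t ^ 0)%C with (RtoC 1) in *.
    field; split; [|assumption].
    replace (zeta t * zeta t)%C with (zeta t ^ 2)%C by ring; assumption.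
Qed.

(** Trades the factor n in the bound for e_n against a larger geometric ratio. *)
Lemma half_pow_linear_bound (n : nat) : INR n * (1 / 2) ^ n <= (3 / 4) ^ n.
Proof.
  assert (H : forall n, INR (S (S n)) * (1 / 2) ^ S (S n) <= (3 / 4) ^ S (S n)).
  { clear n; intros n; induction n as [|n IH]; [simpl; lra|].
    rewrite S_INR.
    change ((1 / 2) ^ S (S (S n))) with (1 / 2 * (1 / 2) ^ S (S n)).
    change ((3 / 4) ^ S (S (S n))) with (3 / 4 * (3 / 4) ^ S (S n)).
    assert (2 <= INR (S (S n))) by (rewrite !S_INR; generalize (pos_INR n); lra).
    assert (0 < (1 / 2) ^ S (S n)) by (apply pow_lt; lra).
    nra. }
  destruct n as [|[|n]]; [simpl; lra | simpl; lra | apply H].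
Qed.

(** The two surviving terms are O((3 / 4)^N) uniformly on the interval, since |zeta| s <= 1 / 2.
    Only the difference of the partial sums is controlled, so nothing about the convergence of
    either sum has to be known here. *)
Lemma flow_sum_transport (m K : R) :
  tau <= t0 -> 0 < m ->
  (forall t, tau <= t <= t0 ->
     m <= D t /\ 0 <= Re (zeta t ^ 2)%C /\ Cmod (zeta t) <= 1 /\
     Cmod (zeta t) * s t <= 1 / 2 /\ 0 <= s t /\ u t <= K /\
     cderive zeta t (zeta t * (- / (D t * (D t + zeta t ^ 2))))%C /\
     forall n, Rabs (er (S n) t) <= 5 / 4 * INR (S n) * (u t * s t ^ n) /\
     Rabs (ei (S n) t) <= 5 / 4 * INR (S n) * (u t * s t ^ n)) ->
  clim (fun N => flow_sum N t0 - flow_sum N tau)%C (RtoC 0).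
Proof.
  intros Ht Hm Hyp.
  assert (HK : 0 <= K).
  { destruct (Hyp t0 ltac:(lra)) as (_ & _ & _ & _ & _ & Hu & _ & He).
    destruct (He 0%nat) as [He0 _].
    generalize (Rabs_pos (er 1 t0)); simpl in He0; lra. }
  assert (Hb : forall t n, tau <= t <= t0 ->
    Cmod (zeta t ^ n * flow_rate n t)%C <= 5 * K * (3 / 4) ^ n).
  { intros t n Htt; destruct (Hyp t Htt) as (_ & _ & Hz1 & Hzs & Hs & Hu & _ & He).
    assert (H34 := half_pow_linear_bound n).
    destruct n as [|n].
    - unfold flow_rate; rewrite (flow_e0 _ _ _ flow_r), (flow_e0 _ _ _ flow_i).
      change (0, 0) with (RtoC 0).
      replace (zeta t ^ 0 * RtoC 0)%C with (RtoC 0) by (simpl; ring).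
      rewrite Cmod_0; simpl; lra.
    - rewrite Cmod_mult, Cmod_pow.
      assert (HE : Cmod (flow_rate (S n) t) <= 5 / 2 * INR (S n) * (K * s t ^ n)).
      { destruct (He n) as [Hr Hi].
        eapply Rle_trans; [apply Cmod_pair_le|].
        assert (Hsn : 0 <= s t ^ n) by (apply pow_le; auto).
        assert (u t * s t ^ n <= K * s t ^ n) by (apply Rmult_le_compat_r; lra).
        assert (Hp := pos_INR (S n)).
        assert (5 / 4 * INR (S n) * (u t * s t ^ n) <=
          5 / 4 * INR (S n) * (K * s t ^ n)) by (apply Rmult_le_compat_l; lra).
        lra. }
      assert (Hc := Cmod_ge_0 (zeta t)).
      eapply Rle_trans.
      + apply Rmult_le_compat_l; [apply pow_le; auto | exact HE].
      + replace (Cmod (zeta t) ^ S n * (5 / 2 * INR (S n) * (K * s t ^ n))) with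
          ((5 / 2 * INR (S n) * K) * (Cmod (zeta t) * (Cmod (zeta t) * s t) ^ n))
          by (rewrite Rpow_mult_distr; simpl; ring).
        assert (Hp : (Cmod (zeta t) * s t) ^ n <= (1 / 2) ^ n).
        { apply pow_incr; split; [apply Rmult_le_pos; auto | auto]. }
        assert (Hp0 : 0 <= (Cmod (zeta t) * s t) ^ n)
          by (apply pow_le, Rmult_le_pos; auto).
        assert (Cmod (zeta t) * (Cmod (zeta t) * s t) ^ n <= (1 / 2) ^ n) by nra.
        eapply Rle_trans.
        * apply Rmult_le_compat_l; [|eassumption].
          repeat apply Rmult_le_pos; try lra; apply pos_INR.
        * replace (5 / 2 * INR (S n) * K * (1 / 2) ^ n) with
            (5 * K * (INR (S n) * (1 / 2) ^ S n)) by (simpl pow; field).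
          apply Rmult_le_compat_l; lra. }
  assert (Hder : forall t N, tau <= t <= t0 ->
    cderive (flow_sum N) t
    ((zeta t ^ (2 + N) * flow_rate N t + zeta t ^ S N * flow_rate (pred N) t)
     / (D t ^ 2 * (D t + zeta t ^ 2)))%C /\
    Cmod ((zeta t ^ (2 + N) * flow_rate N t + zeta t ^ S N * flow_rate (pred N) t)
     / (D t ^ 2 * (D t + zeta t ^ 2)))%C <= 15 * K / m ^ 3 * (3 / 4) ^ N).
  { intros t N Htt; destruct (Hyp t Htt) as (HmD & Hre & Hz1 & _ & _ & _ & Hz & _).
    assert (HD := D_pos t).
    assert (Hmod : m <= Cmod (D t + zeta t ^ 2)%C).
    { eapply Rle_trans; [|apply re_le_Cmod].
      eapply Rle_trans; [|apply Rle_abs].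
      change (m <= D t + Re (zeta t ^ 2)%C); lra. }
    assert (Hne : (D t + zeta t ^ 2 <> RtoC 0)%C).
    { apply Cmod_gt_0; lra. }
    assert (HDne : (D t ^ 2 <> RtoC 0)%C).
    { rewrite <- RtoC_pow; intros E; apply RtoC_inj in E.
      apply pow_nonzero in E; [exact E | lra]. }
    split; [apply flow_sum_derive; assumption|].
    rewrite Cmod_div by (apply Cmult_neq_0; assumption).
    assert (Hden : m ^ 3 <= Cmod (D t ^ 2 * (D t + zeta t ^ 2))%C).
    { rewrite Cmod_mult, Cmod_pow, Cmod_R, Rabs_pos_eq by lra.
      replace (m ^ 3) with (m ^ 2 * m) by ring.
      apply Rmult_le_compat; try lra; [apply pow_le; lra | apply pow_incr; lra]. }
    assert (Hm3 : 0 < m ^ 3) by (apply pow_lt; auto).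
    assert (Hc := Cmod_ge_0 (zeta t)).
    assert (Hnum : Cmod (zeta t ^ (2 + N) * flow_rate N t +
      zeta t ^ S N * flow_rate (pred N) t)%C <= 15 * K * (3 / 4) ^ N).
    { assert (Hz2 : Cmod (zeta t ^ 2)%C <= 1).
      { rewrite Cmod_pow; simpl; nra. }
      assert (H34 : 0 < (3 / 4) ^ N) by (apply pow_lt; lra).
      assert (A1 : Cmod (zeta t ^ (2 + N) * flow_rate N t)%C <= 5 * K * (3 / 4) ^ N).
      { rewrite Cpow_add_r, <- Cmult_assoc, Cmod_mult.
        specialize (Hb t N Htt).
        generalize (Cmod_ge_0 (zeta t ^ N * flow_rate N t)%C)
          (Cmod_ge_0 (zeta t ^ 2)%C); nra. }
      assert (A2 : Cmod (zeta t ^ S N * flow_rate (pred N) t)%C <= 10 * K * (3 / 4) ^ N).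
      { destruct N as [|N].
        - simpl pred; unfold flow_rate.
          rewrite (flow_e0 _ _ _ flow_r), (flow_e0 _ _ _ flow_i).
          change (0, 0) with (RtoC 0).
          rewrite Cmod_mult, Cmod_0; simpl; lra.
        - simpl pred; replace (S (S N)) with (2 + N)%nat by lia.
          rewrite Cpow_add_r, <- Cmult_assoc, Cmod_mult.
          specialize (Hb t N Htt); simpl pow.
          assert (0 <= K * (3 / 4) ^ N)
            by (apply Rmult_le_pos; [lra | apply pow_le; lra]).
          generalize (Cmod_ge_0 (zeta t ^ N * flow_rate N t)%C)
            (Cmod_ge_0 (zeta t ^ 2)%C); nra. }
      eapply Rle_trans; [apply Cmod_triangle|]; lra. }
    replace (15 * K / m ^ 3 * (3 / 4) ^ N) with (15 * K * (3 / 4) ^ N / m ^ 3)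
      by (field; lra).
    apply Rmult_le_compat; try apply Cmod_ge_0; try assumption.
    - left; apply Rinv_0_lt_compat; lra.
    - apply Rinv_le_contravar; assumption. }
  apply (clim_of_bound _ _
    (fun N => 2 * (15 * K / m ^ 3 * (t0 - tau)) * (3 / 4) ^ N)).
  - intros N; replace (flow_sum N t0 - flow_sum N tau - RtoC 0)%C with
      (flow_sum N t0 - flow_sum N tau)%C by ring.
    eapply Rle_trans.
    + apply (cderive_bound_increment (flow_sum N) (fun t =>
       (zeta t ^ (2 + N) * flow_rate N t + zeta t ^ S N * flow_rate (pred N) t)
        / (D t ^ 2 * (D t + zeta t ^ 2)))%C tau t0
       (15 * K / m ^ 3 * (3 / 4) ^ N) Ht);
        intros t Htt; apply (Hder t N Htt).
    + right; ring.
  - replace (Finite 0) with (Rbar_mult (2 * (15 * K / m ^ 3 * (t0 - tau))) 0)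
      by (simpl; f_equal; ring).
    apply is_lim_seq_scal_l, is_lim_seq_geom.
    rewrite Rabs_pos_eq; lra.
Qed.

End FlowTransport.

(** * The Loewner flow in the sector 0 < Im <= Re *)

Lemma is_derive_within_interior {V : NormedModule R_AbsRing} (S : R -> Prop)
    (f : R -> V) (t : R) (l : V) :
  locally t S -> is_derive_within S f t l -> is_derive f t l.
Proof.
  intros HS [Hl Hd]; split; [exact Hl|].
  intros x Hx eps.
  assert (Hx' : is_filter_lim (within S (locally t)) x).
  { intros P HP; apply filter_le_within, Hx, HP. }
  specialize (Hd x Hx' eps); unfold within in Hd.
  apply filter_imp with (2 := filter_and _ _ HS Hd).
  intros y [H1 H2]; apply H2, H1.
Qed.

Lemma is_derive_within_filterlim {V : NormedModule R_AbsRing} (S : R -> Prop)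
    (f : R -> V) (t : R) (l : V) :
  is_derive_within S f t l ->
  filterlim f (within S (locally t)) (locally (f t)).
Proof.
  intros H; apply (filterdiff_continuous_aux (K := R_AbsRing)
    (U := R_NormedModule) (V := V) (F := within S (locally t)) f).
  - eexists; exact H.
  - intros P HP; apply filter_le_within, HP.
Qed.

Lemma is_derive_cderive (f : R -> C) (t : R) (l : C) :
  @is_derive R_AbsRing C_R_NormedModule f t l -> cderive f t l.
Proof.
  intros H; split.
  - exact (filterdiff_comp' (W := R_NormedModule) f (fun z : C_R_NormedModule => fst z) t _ _ H
      (filterdiff_linear _ (is_linear_fst (U := R_NormedModule) (V := R_NormedModule)))).
  - exact (filterdiff_comp' (W := R_NormedModule) f (fun z : C_R_NormedModule => snd z) t _ _ H
      (filterdiff_linear _ (is_linear_snd (U := R_NormedModule) (V := R_NormedModule)))).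
Qed.

Section SectorFlow.

Variables A I D : R -> R.
Variables tau t1 : R.
Hypothesis tau_pos : 0 < tau.
Hypothesis D_pos : forall t, tau <= t <= t1 -> 0 < D t.
Hypothesis I_pos : forall t, tau <= t <= t1 -> 0 < I t.
(* |h - lambda|^2 when A + i I = h - h^+ and D = h^+ - lambda. *)
Definition sing_sqdist (t : R) : R := (A t + D t) ^ 2 + I t ^ 2.
Hypothesis A_derive : forall t, tau <= t <= t1 ->
  is_derive A t (- 2 * (A t * (A t + D t) + I t ^ 2) / (sing_sqdist t * D t)).
Hypothesis I_derive : forall t, tau <= t <= t1 ->
  is_derive I t (- 2 * I t / sing_sqdist t).
Hypothesis sector_end : I t1 <= A t1.

Lemma sing_sqdist_pos (t : R) : tau <= t <= t1 -> 0 < sing_sqdist t.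
Proof.
  intros Ht; specialize (I_pos t Ht); unfold sing_sqdist.
  assert (0 < I t ^ 2) by (apply pow_lt; auto).
  assert (0 <= (A t + D t) ^ 2) by apply pow2_ge_0; lra.
Qed.

(* (A / I)' = - 2 (A^2 + I^2) / (sing_sqdist D I) <= 0. *)
Lemma sector_invariant (t : R) : tau <= t <= t1 -> I t <= A t.
Proof.
  intros Ht.
  assert (H : A t1 / I t1 <= A t / I t).
  { apply (derive_le0_decreasing (fun x => A x / I x)
      (fun x => - 2 * (A x ^ 2 + I x ^ 2) / (sing_sqdist x * D x * I x))); [lra| |].
    - intros x Hx.
      assert (HQ := sing_sqdist_pos x ltac:(lra)); assert (HD := D_pos x ltac:(lra)).
      assert (HI := I_pos x ltac:(lra)).
      evar_last.
      + apply (is_derive_div A I); [apply A_derive; lra | apply I_derive; lra | lra].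
      + field; repeat split; lra.
    - intros x Hx.
      assert (HQ := sing_sqdist_pos x ltac:(lra)); assert (HD := D_pos x ltac:(lra)).
      assert (HI := I_pos x ltac:(lra)).
      assert (0 <= (A x ^ 2 + I x ^ 2) / (sing_sqdist x * D x * I x)).
      { apply Rdiv_le_0_compat.
        - apply Rplus_le_le_0_compat; apply pow2_ge_0.
        - repeat apply Rmult_lt_0_compat; auto. }
      unfold Rdiv in *; lra. }
  assert (H1 := I_pos t1 ltac:(lra)); assert (H2 := I_pos t Ht).
  assert (1 <= A t1 / I t1) by (apply (Rle_div_r 1 (A t1) (I t1)); lra).
  assert (1 * I t <= A t); [|lra].
  apply (Rle_div_r 1 (A t) (I t)); lra.
Qed.

Lemma sector_A_decreasing (t : R) : tau <= t <= t1 -> A t1 <= A t.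
Proof.
  intros Ht.
  apply (derive_le0_decreasing A
    (fun t => - 2 * (A t * (A t + D t) + I t ^ 2) / (sing_sqdist t * D t)));
    [lra | intros; apply A_derive; lra |].
  intros x Hx.
  assert (HQ := sing_sqdist_pos x ltac:(lra)); assert (HD := D_pos x ltac:(lra)).
  assert (HI := I_pos x ltac:(lra)); assert (HA := sector_invariant x ltac:(lra)).
  assert (0 <= (A x * (A x + D x) + I x ^ 2) / (sing_sqdist x * D x)).
  { apply Rdiv_le_0_compat; [nra | apply Rmult_lt_0_compat; auto]. }
  unfold Rdiv in *; lra.
Qed.

Definition sqdist (t : R) : R := A t ^ 2 + I t ^ 2.

(** For w = h - h^+ one has w' = - 2 w / ((h - lambda) D), so log |w|^2 has derivative - 4 Re (1 /
    (h - lambda)) / D. *)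
Lemma sqdist_derive (t : R) : tau <= t <= t1 ->
  is_derive sqdist t (- 4 * (A t + D t) / (sing_sqdist t * D t) * sqdist t).
Proof.
  intros Ht; assert (HQ := sing_sqdist_pos t Ht); assert (HD := D_pos t Ht).
  evar_last.
  - apply (is_derive_Rplus (fun x => A x ^ 2) (fun x => I x ^ 2)).
    + apply is_derive_pow, A_derive, Ht.
    + apply is_derive_pow, I_derive, Ht.
  - unfold sqdist, sing_sqdist in *; simpl; field; split; simpl in HQ; lra.
Qed.

(** In the sector (A + D) D <= |h - lambda|^2, so the logarithmic rate is at most 4 / D^2 <= 16 /
    tau. The crude exponential is enough: tau is fixed before the test points are made small. *)
Lemma sqdist_upper (t : R) :
  (forall x, tau <= x <= t1 -> sqrt x / 2 <= D x) -> tau <= t <= t1 ->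
  sqdist t <= sqdist t1 * exp (16 * t1 / tau).
Proof.
  intros HDs Ht.
  assert (H : - (sqdist t1 * exp (16 * t1 / tau)) <= - (sqdist t * exp (16 * t / tau))).
  { apply (derive_le0_decreasing (fun x => - (sqdist x * exp (16 * x / tau)))
      (fun x => - ((- 4 * (A x + D x) / (sing_sqdist x * D x) + 16 / tau) *
        (sqdist x * exp (16 * x / tau))))); [lra| |].
    - intros x Hx; evar_last.
      + apply (is_derive_opp (fun x => sqdist x * exp (16 * x / tau))).
        apply is_derive_Rmult; [apply sqdist_derive; lra|].
        instantiate (1 := 16 / tau * exp (16 * x / tau)).
        auto_derive; [exact Logic.I | unfold Rdiv; ring].
      + unfold opp; simpl; ring.
    - intros x Hx.
      assert (HQ := sing_sqdist_pos x ltac:(lra)); assert (HD := D_pos x ltac:(lra)).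
      assert (HI := I_pos x ltac:(lra)); assert (HA := sector_invariant x ltac:(lra)).
      specialize (HDs x ltac:(lra)).
      assert (Hs := sqrt_sqrt x ltac:(lra)); assert (Hs0 := sqrt_lt_R0 x ltac:(lra)).
      assert (HD2 : tau <= 4 * D x ^ 2) by nra.
      assert (E : 4 * (A x + D x) / (sing_sqdist x * D x) <= 16 / tau).
      { apply (Rle_div_l (4 * (A x + D x))); [apply Rmult_lt_0_compat; auto|].
        replace (16 / tau * (sing_sqdist x * D x)) with (16 * sing_sqdist x * D x / tau) by (field; lra).
        apply (Rle_div_r (4 * (A x + D x))); [auto|].
        assert ((A x + D x) * D x <= sing_sqdist x) by (unfold sing_sqdist; nra).
        assert (4 * (A x + D x) * tau <= 4 * (A x + D x) * (4 * D x ^ 2))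
          by (apply Rmult_le_compat_l; lra).
        assert (((A x + D x) * D x) * D x <= sing_sqdist x * D x)
          by (apply Rmult_le_compat_r; lra).
        lra. }
      assert (0 <= sqdist x * exp (16 * x / tau)).
      { apply Rmult_le_pos; [|left; apply exp_pos].
        apply Rplus_le_le_0_compat; apply pow2_ge_0. }
      assert (0 <= - 4 * (A x + D x) / (sing_sqdist x * D x) + 16 / tau)
        by (unfold Rdiv in *; lra).
      nra. }
  assert (H0 : 0 <= sqdist t) by (apply Rplus_le_le_0_compat; apply pow2_ge_0).
  assert (1 <= exp (16 * t / tau)).
  { assert (0 <= 16 * t / tau) by (apply Rdiv_le_0_compat; lra).
    generalize (exp_ineq1_le (16 * t / tau)); lra. }
  nra.
Qed.

(** A small gap forces |w|^2 to decrease at least like x^(-2): the logarithmic rate is then at least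
    2 / x. *)
Lemma sqdist_decay :
  tau <= t1 ->
  (forall x, tau <= x <= t1 -> D x <= 3 / 5 * sqrt x /\ A x <= sqrt x) ->
  sqdist t1 * t1 ^ 2 <= sqdist tau * tau ^ 2.
Proof.
  intros Ht HDs.
  apply (derive_le0_decreasing (fun x => sqdist x * x ^ 2)
    (fun x => (- 4 * (A x + D x) / (sing_sqdist x * D x) + 2 / x) * (sqdist x * x ^ 2)));
    [lra| |].
  - intros x Hx; evar_last.
    + apply is_derive_Rmult; [apply sqdist_derive; lra|].
      apply is_derive_pow, (is_derive_id (K := R_AbsRing)).
    + unfold one; simpl; field; assert (HQ := sing_sqdist_pos x ltac:(lra));
      assert (HD := D_pos x ltac:(lra)); repeat split; lra.
  - intros x Hx.
    assert (HQ := sing_sqdist_pos x ltac:(lra)); assert (HD := D_pos x ltac:(lra)).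
    assert (HI := I_pos x ltac:(lra)); assert (HA := sector_invariant x ltac:(lra)).
    destruct (HDs x ltac:(lra)) as [H1 H2].
    assert (Hs := sqrt_sqrt x ltac:(lra)); assert (Hs0 := sqrt_lt_R0 x ltac:(lra)).
    assert (E : 2 / x <= 4 * (A x + D x) / (sing_sqdist x * D x)).
    { apply (Rle_div_r (2 / x)); [apply Rmult_lt_0_compat; auto|].
      replace (2 / x * (sing_sqdist x * D x)) with (2 * sing_sqdist x * D x / x) by (field; lra).
      apply (Rle_div_l (2 * sing_sqdist x * D x)); [lra|].
      (* The sector enters through I^2 <= A^2. Next, D (2 A + D) <= (3 / 5) (2 + 3 / 5) x = (39 /
         25) x, which leaves room below 2 x. *)
      assert (HQ1 : sing_sqdist x <= (A x + D x) * (2 * A x + D x)) by (unfold sing_sqdist; nra).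
      assert (HDA : D x * (2 * A x + D x) <= 2 * x) by nra.
      assert (2 * sing_sqdist x * D x <= 2 * ((A x + D x) * (2 * A x + D x)) * D x)
        by (apply Rmult_le_compat_r; lra).
      assert ((A x + D x) * (D x * (2 * A x + D x)) <= (A x + D x) * (2 * x))
        by (apply Rmult_le_compat_l; lra).
      lra. }
    assert (0 <= sqdist x * x ^ 2).
    { apply Rmult_le_pos; [|apply pow2_ge_0].
      apply Rplus_le_le_0_compat; apply pow2_ge_0. }
    assert (- 4 * (A x + D x) / (sing_sqdist x * D x) + 2 / x <= 0)
      by (unfold Rdiv in *; lra).
    nra.
Qed.

End SectorFlow.

(** * The square root along curves in the upper half-plane *)

Lemma Csqrt_upper_components (a v : R) : 0 < v ->
  exists x y, Csqrt (a, v) = (x, y) /\ 0 < x /\ 0 < y /\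
    x = sqrt ((sqrt (a ^ 2 + v ^ 2) + a) / 2) /\
    y = sqrt ((sqrt (a ^ 2 + v ^ 2) - a) / 2) /\
    x ^ 2 + y ^ 2 = sqrt (a ^ 2 + v ^ 2) /\ x ^ 2 - y ^ 2 = a /\ 2 * x * y = v.
Proof.
  intros Hv.
  assert (Hsq := Csqrt_sqr (a, v)).
  assert (Hm : Rabs a < sqrt (a ^ 2 + v ^ 2)).
  { rewrite <- sqrt_Rsqr_abs; apply sqrt_lt_1_alt; unfold Rsqr; split; nra. }
  assert (Hm1 : a < sqrt (a ^ 2 + v ^ 2)) by (eapply Rle_lt_trans; [apply Rle_abs|exact Hm]).
  assert (Hm2 : - a < sqrt (a ^ 2 + v ^ 2)).
  { eapply Rle_lt_trans; [apply Rle_abs|]; rewrite Rabs_Ropp; exact Hm. }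
  set (m := sqrt (a ^ 2 + v ^ 2)) in *.
  exists (sqrt ((m + a) / 2)), (sqrt ((m - a) / 2)).
  assert (E : Csqrt (a, v) = (sqrt ((m + a) / 2), sqrt ((m - a) / 2))).
  { unfold Csqrt, Cmod, Re, Im; simpl fst; simpl snd; fold m.
    destruct (Rle_dec 0 v) as [_|H]; [|lra]; rewrite Rmult_1_l; reflexivity. }
  assert (S1 := sqrt_sqrt ((m + a) / 2) ltac:(lra)).
  assert (S2 := sqrt_sqrt ((m - a) / 2) ltac:(lra)).
  rewrite E in Hsq; apply (f_equal snd) in Hsq; simpl in Hsq.
  repeat split; auto; try (apply sqrt_lt_R0; lra); simpl; lra.
Qed.

(** Differentiates the explicit components. Positivity of [I] near [t] stays off the cut and fixes
    the sign chosen in [Csqrt]. *)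
Lemma cderive_Csqrt (A I : R -> R) (t dA dI : R) :
  0 < I t -> locally t (fun s => 0 < I s) ->
  is_derive A t dA -> is_derive I t dI ->
  cderive (fun s => Csqrt (A s, I s)) t ((dA, dI) / (2 * Csqrt (A t, I t)))%C.
Proof.
  intros Ht Hloc HA HI.
  destruct (Csqrt_upper_components (A t) (I t) Ht)
    as (x & y & E & Hx & Hy & Ex & Ey & Em & Ed & Ep).
  set (m := fun s => sqrt (A s ^ 2 + I s ^ 2)).
  assert (Hm0 : 0 < m t) by (unfold m; rewrite <- Em; nra).
  assert (Hm : is_derive m t ((A t * dA + I t * dI) / m t)).
  { evar_last.
    - apply (is_derive_sqrt (fun s => A s ^ 2 + I s ^ 2)).
      + apply is_derive_Rplus; apply is_derive_pow; eassumption.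
      + assert (0 <= A t ^ 2) by apply pow2_ge_0.
        assert (0 < I t ^ 2) by (apply pow_lt; auto); lra.
    - fold (m t); simpl; field; lra. }
  assert (Hx2 : x ^ 2 = (m t + A t) / 2) by (unfold m; lra).
  assert (Hy2 : y ^ 2 = (m t - A t) / 2) by (unfold m; lra).
  assert (Hxd : is_derive (fun s => sqrt ((m s + A s) / 2)) t
     (((A t * dA + I t * dI) / m t + dA) / 2 / (2 * x))).
  { rewrite Ex; fold (m t).
    apply (is_derive_sqrt (fun s => (m s + A s) / 2) t
      (((A t * dA + I t * dI) / m t + dA) / 2)).
    - apply (is_derive_ext (fun s => / 2 * (m s + A s))); [intros; simpl; field|].
      evar_last.
      + apply is_derive_scal, is_derive_Rplus; eassumption.
      + simpl; field; lra.
    - rewrite <- Hx2; apply pow_lt; auto. }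
  assert (Hyd : is_derive (fun s => sqrt ((m s - A s) / 2)) t
     (((A t * dA + I t * dI) / m t - dA) / 2 / (2 * y))).
  { rewrite Ey; fold (m t).
    apply (is_derive_sqrt (fun s => (m s - A s) / 2) t
      (((A t * dA + I t * dI) / m t - dA) / 2)).
    - apply (is_derive_ext (fun s => / 2 * (m s - A s))); [intros; simpl; field|].
      evar_last.
      + apply is_derive_scal, is_derive_Rminus; eassumption.
      + simpl; field; lra.
    - rewrite <- Hy2; apply pow_lt; auto. }
  assert (Hmt : m t = x ^ 2 + y ^ 2) by (unfold m; lra).
  rewrite Hmt, <- Ed, <- Ep in Hxd, Hyd.
  rewrite E; split.
  - apply is_derive_ext_loc with (fun s => sqrt ((m s + A s) / 2)).
    + apply filter_imp with (2 := Hloc); intros s Hs.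
      destruct (Csqrt_upper_components (A s) (I s) Hs)
        as (x' & y' & E' & _ & _ & Ex' & _); rewrite E'; simpl; rewrite Ex'.
      reflexivity.
    + evar_last; [exact Hxd|]; simpl; field; repeat split; nra.
  - apply is_derive_ext_loc with (fun s => sqrt ((m s - A s) / 2)).
    + apply filter_imp with (2 := Hloc); intros s Hs.
      destruct (Csqrt_upper_components (A s) (I s) Hs)
        as (x' & y' & E' & _ & _ & _ & Ey' & _); rewrite E'; simpl; rewrite Ey'.
      reflexivity.
    + evar_last; [exact Hyd|]; simpl; field; repeat split; nra.
Qed.

Lemma Csqrt_pow2 (w : C) : (Csqrt w ^ 2)%C = w.
Proof.
  transitivity (Csqrt w * Csqrt w)%C; [simpl; ring | apply Csqrt_sqr].
Qed.

Lemma Csqrt_norm (a v : R) : Cmod (Csqrt (a, v)) ^ 4 = a ^ 2 + v ^ 2.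
Proof.
  replace (Cmod (Csqrt (a, v)) ^ 4) with (Cmod (Csqrt (a, v) * Csqrt (a, v))%C ^ 2)
    by (rewrite Cmod_mult; ring).
  rewrite Csqrt_sqr; unfold Cmod; simpl fst; simpl snd.
  apply pow2_sqrt; assert (H1 := pow2_ge_0 a); assert (H2 := pow2_ge_0 v); lra.
Qed.

(** * Bounds for the coefficients of the inverse *)

Lemma at_right_0_elim (f : R -> R) (l eps : R) :
  filterlim f (at_right 0) (locally l) -> 0 < eps ->
  exists delta, 0 < delta /\ forall t, 0 < t < delta -> Rabs (f t - l) < eps.
Proof.
  intros H He.
  destruct (proj1 (filterlim_locally f l) H (mkposreal eps He)) as [d Hd].
  exists d; split; [apply cond_pos|]; intros t Ht.
  apply (Hd t); [|lra].
  change (Rabs (t - 0) < d); rewrite Rminus_0_r, Rabs_pos_eq; lra.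
Qed.

Lemma locally_between (a b t : R) : a < t < b -> locally t (fun s => a < s < b).
Proof.
  intros H.
  assert (Hd : 0 < Rmin (t - a) (b - t)) by (apply Rmin_pos; lra).
  exists (mkposreal _ Hd); intros s Hs.
  change (Rabs (s - t) < Rmin (t - a) (b - t)) in Hs.
  apply Rabs_def2 in Hs.
  generalize (Rmin_l (t - a) (b - t)) (Rmin_r (t - a) (b - t)); lra.
Qed.

Lemma Lip_half_continuous (T : R) (lambda : R -> R) (t : R) :
  Lip_half T lambda -> 0 < t < T -> continuous lambda t.
Proof.
  intros [K HK] Ht; apply filterlim_locally; intros eps.
  assert (He := cond_pos eps).
  set (K1 := Rabs K + 1); assert (HK1 : 0 < K1) by (unfold K1; generalize (Rabs_pos K); lra).
  assert (Hd : 0 < Rmin ((eps / K1) ^ 2) (Rmin t (T - t))).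
  { apply Rmin_pos; [apply pow_lt, Rdiv_lt_0_compat; auto | apply Rmin_pos; lra]. }
  exists (mkposreal _ Hd); intros s Hs.
  change (Rabs (s - t) < Rmin ((eps / K1) ^ 2) (Rmin t (T - t))) in Hs.
  assert (H1 : Rabs (s - t) < (eps / K1) ^ 2)
    by (eapply Rlt_le_trans; [exact Hs | apply Rmin_l]).
  assert (H2 : Rabs (s - t) < Rmin t (T - t))
    by (eapply Rlt_le_trans; [exact Hs | apply Rmin_r]).
  assert (Hst := Rabs_def2 _ _ H2).
  assert (M1 := Rmin_l t (T - t)); assert (M2 := Rmin_r t (T - t)).
  change (Rabs (lambda s - lambda t) < eps).
  eapply Rle_lt_trans; [apply HK; unfold segment; lra|].
  assert (Hq : sqrt (Rabs (s - t)) < eps / K1).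
  { rewrite <- (sqrt_pow2 (eps / K1)) by (left; apply Rdiv_lt_0_compat; auto).
    apply sqrt_lt_1_alt; split; [apply Rabs_pos | exact H1]. }
  assert (Hq0 := sqrt_pos (Rabs (s - t))).
  assert (K * sqrt (Rabs (s - t)) <= K1 * sqrt (Rabs (s - t))).
  { apply Rmult_le_compat_r; [auto|]; unfold K1; generalize (Rle_abs K); lra. }
  assert (K1 * sqrt (Rabs (s - t)) < K1 * (eps / K1)) by (apply Rmult_lt_compat_l; auto).
  replace (K1 * (eps / K1)) with (pos eps) in * by (field; lra); lra.
Qed.

(** A series without constant term is O(|z|). Applied to the half-power expansion, it bounds |z|^2
    by a multiple of |h - h^+|. *)
Lemma power_series_small (d : nat -> C) (K r : R) (z l : C) :
  0 <= K -> 0 < r -> (forall n, Cmod (d n) <= K * r ^ n) ->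
  Cmod z * r <= 1 / 2 -> clim (csum (fun k => d k * z ^ S k)%C) l ->
  Cmod l <= 2 * K * Cmod z.
Proof.
  intros HK Hr Hd Hz Hl.
  assert (Hz0 := Cmod_ge_0 z).
  assert (Hs : forall n, Cmod (csum (fun k => d k * z ^ S k)%C n) <=
    K * Cmod z * (2 - 2 * (1 / 2) ^ n)).
  { induction n as [|n IH]; simpl csum.
    - rewrite Cmod_0; simpl; lra.
    - eapply Rle_trans; [apply Cmod_triangle|].
      assert (H : Cmod (d n * z ^ S n)%C <= K * Cmod z * (1 / 2) ^ n).
      { rewrite Cmod_mult, Cmod_pow.
        eapply Rle_trans; [apply Rmult_le_compat_r; [apply pow_le; auto | apply Hd]|].
        replace (K * r ^ n * Cmod z ^ S n) with (K * Cmod z * (Cmod z * r) ^ n)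
          by (rewrite Rpow_mult_distr; simpl; ring).
        apply Rmult_le_compat_l; [apply Rmult_le_pos; auto|].
        apply pow_incr; split; [apply Rmult_le_pos; lra | lra]. }
      change (z ^ S n)%C with (z * z ^ n)%C in H.
      replace ((1 / 2) ^ S n) with ((1 / 2) ^ n / 2) by (simpl; field); simpl in *; lra. }
  apply Rnot_lt_le; intros H.
  destruct (Hl (Cmod l - 2 * K * Cmod z) ltac:(lra)) as [N HN].
  specialize (HN N (le_n N)); specialize (Hs N).
  assert (0 < (1 / 2) ^ N) by (apply pow_lt; lra).
  assert (0 <= K * Cmod z) by (apply Rmult_le_pos; auto).
  assert (Cmod l <= Cmod (csum (fun k => d k * z ^ S k)%C N - l)%C +
    Cmod (csum (fun k => d k * z ^ S k)%C N)).
  { set (S := csum _ N); replace l with (S + - (S - l))%C at 1 by ring.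
    eapply Rle_trans; [apply Cmod_triangle|]; rewrite Cmod_opp; lra. }
  nra.
Qed.

(** * The Loewner maps near the right prime end *)

Section Loewner.

Variables (T : R) (lambda : R -> R) (gamma : R -> C) (h hinv : C -> R -> C).
Variables (hm hp : R -> R) (bn : nat -> R -> C).
Hypothesis T_pos : 0 < T.
Hypothesis lambda_lip : Lip_half T lambda.
Hypothesis gamma_slit : simple_slit T gamma.
Hypothesis h_loewner : loewner_slit_maps T lambda gamma h.
Hypothesis h_reflected : reflected_slit_maps T lambda gamma h hm hp.
Hypothesis h_inverse : forall t, 0 < t <= T ->
  inverse_onto (fun z => h z t) (fun w => hinv w t)
    (setC (double_slit gamma t)) (setC (real_interval (hm t) (hp t))).
Hypothesis h_expansion : forall t, 0 < t <= T ->
  half_power_expansion (fun w => hinv w t)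
    (setC (real_interval (hm t) (hp t))) (hp t) (fun n => bn n t).

Definition gap (t : R) : R := hp t - lambda t.
Definition offset_re (z : C) (t : R) : R := Re (h z t) - hp t.
Definition offset_im (z : C) (t : R) : R := Im (h z t).

Lemma segment_interior (t : R) : 0 < t < T -> locally t (segment T).
Proof.
  intros Ht; apply filter_imp with (2 := locally_between 0 T t Ht).
  intros s Hs; unfold segment; lra.
Qed.

Lemma hp_derive (t : R) : 0 < t < T -> is_derive hp t (2 / gap t).
Proof.
  intros Ht; apply (is_derive_within_interior (V := R_NormedModule) (segment T)).
  - apply segment_interior, Ht.
  - apply (right_singular_solution _ _ _ _ _ _ h_reflected); lra.
Qed.

Lemma gap_continuous (t : R) : 0 < t < T -> continuous gap t.
Proof.
  intros Ht; apply (continuous_minus (V := R_NormedModule)).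
  - eapply is_derive_cont, hp_derive, Ht.
  - apply (Lip_half_continuous T); assumption.
Qed.

Lemma not_slit_le (z : C) (s t : R) : s <= t -> ~ slit gamma t z -> ~ slit gamma s z.
Proof. intros Hst H [r [Hr E]]; apply H; exists r; split; [lra | exact E]. Qed.

Lemma offset_derive (z : C) (t : R) :
  0 < t < T -> upper_half z -> ~ slit gamma t z -> 0 < gap t ->
  let A := offset_re z in let I := offset_im z in
  0 < I t /\
  is_derive A t
    (- 2 * (A t * (A t + gap t) + I t ^ 2) / (sing_sqdist A I gap t * gap t)) /\
  is_derive I t (- 2 * I t / sing_sqdist A I gap t).
Proof.
  intros Ht Hz Hs Hg A I.
  assert (HI : 0 < I t).
  { apply (loewner_conformal _ _ _ _ h_loewner t); [unfold segment; lra|].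
    exists z; repeat split; assumption. }
  assert (Hd : cderive (h z) t (2 / (h z t - lambda t))%C).
  { apply is_derive_cderive, (is_derive_within_interior (segment T)).
    - apply segment_interior, Ht.
    - apply (loewner_equation _ _ _ _ h_loewner); unfold segment; auto; lra. }
  destruct Hd as [Hr Hi].
  assert (HQ : 0 < sing_sqdist A I gap t).
  { unfold sing_sqdist; assert (0 < I t ^ 2) by (apply pow_lt; auto).
    generalize (pow2_ge_0 (A t + gap t)); lra. }
  assert (EQ : sing_sqdist A I gap t = (Re (h z t) - lambda t) ^ 2 + Im (h z t) ^ 2).
  { unfold sing_sqdist, A, I, offset_re, offset_im, gap; ring. }
  split; [exact HI|]; split.
  - evar_last; [exact (is_derive_Rminus _ _ _ _ _ Hr (hp_derive t Ht))|].
    assert (E : Re (2 / (h z t - lambda t))%C = 2 * (A t + gap t) / sing_sqdist A I gap t).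
    { rewrite EQ in *; unfold A, I, offset_re, offset_im, gap in *.
      destruct (h z t) as [a v]; simpl in *; field; simpl in *; lra. }
    rewrite E; unfold sing_sqdist in *; field; simpl in *; lra.
  - evar_last; [exact Hi|].
    rewrite EQ in *; unfold A, I, offset_re, offset_im, gap in *.
    destruct (h z t) as [a v]; simpl in *; field; simpl in *; lra.
Qed.

Lemma offset_preimage (t : R) (a v : R) : 0 < t <= T -> 0 < v ->
  exists z, upper_half z /\ ~ slit gamma t z /\
    offset_re z t = a /\ offset_im z t = v.
Proof.
  intros Ht Hv.
  destruct (proj1 (proj2 (proj2 (loewner_conformal _ _ _ _ h_loewner t
    ltac:(unfold segment; lra))) (hp t + a, v)) Hv) as [z [[Hz Hs] E]].
  exists z; unfold offset_re, offset_im; rewrite E; simpl.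
  repeat split; auto; ring.
Qed.

Lemma offset_C (z : C) (t : R) :
  (h z t - hp t)%C = (offset_re z t, offset_im z t).
Proof.
  unfold offset_re, offset_im; destruct (h z t).
  apply injective_projections; simpl; ring.
Qed.

(** A point of the upper half-plane off the slit is off the double slit: the reflected slit lies in
    the lower half-plane and gamma 0 is real. *)
Lemma slit_map_inverse (z : C) (t : R) :
  0 < t <= T -> upper_half z -> ~ slit gamma t z -> hinv (h z t) t = z.
Proof.
  intros Ht Hz Hs; apply (h_inverse t Ht).
  unfold upper_half in Hz; intros [H|[[s [H1 H2]]|H]].
  - exact (Hs H).
  - assert (H3 := slit_upper _ _ gamma_slit s ltac:(lra)).
    unfold upper_half in H3; rewrite H2 in H3; destruct z; simpl in *; lra.
  - rewrite (slit_origin _ _ gamma_slit) in H; rewrite H in Hz; simpl in Hz; lra.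
Qed.

Lemma expansion_at (t : R) : 0 < t <= T ->
  exists K r rho, 0 <= K /\ 0 < r /\ 0 < rho /\
    (forall n, Cmod (bn (S n) t) <= K * r ^ n) /\
    (forall z, upper_half z -> ~ slit gamma t z ->
       0 < offset_im z t ->
       offset_re z t ^ 2 + offset_im z t ^ 2 < rho ->
       clim (csum (fun k => bn (S k) t *
         Csqrt (offset_re z t, offset_im z t) ^ S k)%C) z).
Proof.
  intros Ht; destruct (h_expansion t Ht) as [rho [Hrho Hexp]].
  assert (Hser : forall z, upper_half z -> ~ slit gamma t z ->
       0 < offset_im z t -> offset_re z t ^ 2 + offset_im z t ^ 2 < rho ^ 2 ->
       clim (csum (fun k => bn (S k) t *
         Csqrt (offset_re z t, offset_im z t) ^ S k)%C) z).
  { intros z Hz Hs HI Hsm; apply is_series_clim.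
    assert (HV : setC (real_interval (hm t) (hp t)) (h z t)).
    { intros [H _]; unfold offset_im in HI; lra. }
    assert (Hb : Cmod (h z t - hp t)%C < rho).
    { rewrite offset_C; unfold Cmod; simpl fst; simpl snd.
      rewrite <- (sqrt_pow2 rho) by lra; apply sqrt_lt_1_alt; split; [|exact Hsm].
      apply Rplus_le_le_0_compat; apply pow2_ge_0. }
    assert (H := Hexp _ HV Hb); cbv beta in H.
    rewrite offset_C, slit_map_inverse in H by assumption; exact H. }
  (* The point with offset i rho / 2 lies inside the region of convergence, and this one point
     yields the geometric bound on the coefficients. *)
  destruct (offset_preimage t 0 (rho / 2) Ht ltac:(lra)) as (z & Hz & Hs & E1 & E2).
  specialize (Hser z Hz Hs) as H; rewrite E1, E2 in H.
  specialize (H ltac:(lra) ltac:(nra)).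
  assert (Hne : Csqrt (0, rho / 2) <> RtoC 0).
  { intros E; assert (N := Csqrt_norm 0 (rho / 2)).
    rewrite E, Cmod_0 in N; simpl in N; nra. }
  destruct (power_series_coef_bound _ _ _ Hne H) as (K & r & HK & Hr & Hb).
  exists K, r, (rho ^ 2).
  split; [exact HK|]; split; [exact Hr|]; split; [apply pow_lt; auto|].
  split; assumption.
Qed.

(** At t = 0 the Loewner equation is a derivative relative to [0,T]; it gives right-continuity
    there, where h(z,0) = z. *)
Lemma slit_map_initial_limit (z : C) (eps : R) :
  upper_half z -> 0 < eps -> exists delta, 0 < delta /\
    forall t, 0 < t < delta -> t <= T -> Rabs (Re (h z t) - Re z) < eps.
Proof.
  intros Hz He.
  assert (H0 : segment T 0) by (unfold segment; lra).
  assert (Hs : ~ slit gamma 0 z) by (intros [s [Hs _]]; lra).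
  assert (H := is_derive_within_filterlim _ _ _ _
    (loewner_equation _ _ _ _ h_loewner z 0 Hz H0 Hs)).
  destruct (proj1 (filterlim_locally _ _) H (mkposreal eps He)) as [d Hd].
  exists d; split; [apply cond_pos|]; intros t Ht HT.
  assert (Hb : ball (0 : R_UniformSpace) d t).
  { change (Rabs (t - 0) < d); rewrite Rminus_0_r, Rabs_pos_eq; lra. }
  destruct (Hd t Hb) as [H1 _]; [unfold segment; lra|].
  rewrite (loewner_initial _ _ _ _ h_loewner z Hz) in H1; exact H1.
Qed.

Section FixedTime.

Variable t1 : R.
Hypothesis t1_range : 0 < t1 < T.
Hypothesis gap_pos : forall t, 0 < t <= t1 -> 0 < gap t.
Variable z : C.
Hypothesis z_upper : upper_half z.
Hypothesis z_slit : ~ slit gamma t1 z.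
Hypothesis z_sector : offset_im z t1 <= offset_re z t1.

Let A := offset_re z.
Let I := offset_im z.

Lemma offset_flow (t : R) : 0 < t <= t1 ->
  0 < I t /\
  is_derive A t
    (- 2 * (A t * (A t + gap t) + I t ^ 2) / (sing_sqdist A I gap t * gap t)) /\
  is_derive I t (- 2 * I t / sing_sqdist A I gap t).
Proof.
  intros Ht; apply offset_derive; auto; [lra|].
  apply not_slit_le with t1; [lra | auto].
Qed.

Lemma offset_sector (t : R) : 0 < t <= t1 -> I t <= A t.
Proof.
  intros Ht; apply (sector_invariant A I gap t t1); try lra; try exact z_sector;
    intros s Hs; try apply gap_pos; try apply offset_flow; lra.
Qed.

Lemma offset_re_decreasing (s t : R) : 0 < s <= t -> t <= t1 -> A t <= A s.
Proof.
  intros Hs Ht; apply (sector_A_decreasing A I gap s t); try lra;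
    try (apply offset_sector; lra);
    intros x Hx; try apply gap_pos; try apply offset_flow; lra.
Qed.

(** Re (h - h^+) decreases in time and tends to Re z as t -> 0+, because h(z,0) = z and h^+ tends to
    0. *)
Lemma offset_re_le (t : R) : 0 < t <= t1 -> A t <= Re z.
Proof.
  intros Ht; apply Rnot_lt_le; intros H.
  destruct (slit_map_initial_limit z ((A t - Re z) / 2) z_upper ltac:(lra))
    as [d1 [Hd1 H1]].
  destruct (at_right_0_elim hp 0 ((A t - Re z) / 2)
    (right_singular_initial _ _ _ _ _ _ h_reflected) ltac:(lra)) as [d2 [Hd2 H2]].
  set (s := Rmin (t / 2) (Rmin (d1 / 2) (d2 / 2))).
  assert (Hs : 0 < s) by (repeat apply Rmin_pos; lra).
  assert (Hst : s <= t / 2) by apply Rmin_l.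
  assert (Hs12 : s <= Rmin (d1 / 2) (d2 / 2)) by apply Rmin_r.
  assert (M1 := Rmin_l (d1 / 2) (d2 / 2)); assert (M2 := Rmin_r (d1 / 2) (d2 / 2)).
  specialize (H1 s ltac:(lra) ltac:(lra)); specialize (H2 s ltac:(lra)).
  apply Rabs_def2 in H1; apply Rabs_def2 in H2.
  assert (Hd := offset_re_decreasing s t ltac:(lra) ltac:(lra)).
  unfold A, offset_re in *; lra.
Qed.

Lemma offset_upper (tau t : R) :
  (forall x, 0 < x <= t1 -> sqrt x / 2 <= gap x) -> 0 < tau <= t -> t <= t1 ->
  A t ^ 2 + I t ^ 2 <= (A t1 ^ 2 + I t1 ^ 2) * exp (16 * t1 / tau).
Proof.
  intros Hg Htau Ht.
  apply (sqdist_upper A I gap tau t1); try lra; try exact z_sector;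
    intros x Hx; try apply gap_pos; try apply Hg; try apply offset_flow; lra.
Qed.

(** The decay is started at time |z|^2: from then on A <= |z| <= sqrt x, as [sqdist_decay] requires,
    and at that time the sector gives |h - h^+|^2 <= 2 |z|^2. *)
Lemma offset_decay :
  (forall x, 0 < x <= t1 -> gap x <= 3 / 5 * sqrt x) ->
  Cmod z ^ 2 <= t1 ->
  (A t1 ^ 2 + I t1 ^ 2) * t1 ^ 2 <= 2 * Cmod z ^ 6.
Proof.
  intros Hg Hz.
  set (X := Cmod z) in *.
  assert (HX : 0 < X).
  { apply Cmod_gt_0; intros E; unfold upper_half in z_upper; rewrite E in z_upper.
    simpl in z_upper; lra. }
  assert (HX2 : 0 < X ^ 2) by (apply pow_lt; auto).
  assert (HA : forall t, 0 < t <= t1 -> A t <= X).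
  { intros t Ht; eapply Rle_trans; [apply offset_re_le, Ht|].
    eapply Rle_trans; [apply Rle_abs | apply re_le_Cmod]. }
  assert (H := sqdist_decay A I gap (X ^ 2) t1).
  assert (H' : sqdist A I t1 * t1 ^ 2 <= sqdist A I (X ^ 2) * (X ^ 2) ^ 2).
  { apply H; try lra; try exact z_sector;
      try (intros x Hx; try apply gap_pos; try apply offset_flow; lra).
    intros x Hx; split; [apply Hg; lra|].
    apply Rle_trans with X; [apply HA; lra|].
    rewrite <- (sqrt_pow2 X) by lra; apply sqrt_le_1_alt; lra. }
  assert (HI := proj1 (offset_flow (X ^ 2) ltac:(lra))).
  assert (HS := offset_sector (X ^ 2) ltac:(lra)).
  assert (HAX := HA (X ^ 2) ltac:(lra)).
  unfold sqdist in H'.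
  assert (A (X ^ 2) ^ 2 + I (X ^ 2) ^ 2 <= 2 * X ^ 2) by nra.
  assert ((A (X ^ 2) ^ 2 + I (X ^ 2) ^ 2) * (X ^ 2) ^ 2 <= 2 * X ^ 2 * (X ^ 2) ^ 2).
  { apply Rmult_le_compat_r; [apply pow2_ge_0 | assumption]. }
  replace (2 * X ^ 6) with (2 * X ^ 2 * (X ^ 2) ^ 2) by ring; lra.
Qed.

End FixedTime.

(* A gap of at most (1/2 + o(1)) sqrt t would make h(z,t1) - hp t1 decay at least
   like |z|^3, whereas the half-power expansion only allows |z|^2. *)
Lemma gap_ratio_gt_half (l : R) :
  0 < l -> filterlim (fun t => gap t / sqrt t) (at_right 0) (locally l) -> 1 / 2 < l.
Proof.
  intros Hl0 Hl; apply Rnot_le_lt; intros Hle.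
  (* The tolerance 1 / 10 turns l <= 1 / 2 into the ratio 3 / 5; the tolerance l keeps the gap
     positive. *)
  destruct (at_right_0_elim _ _ (Rmin (1 / 10) l) Hl ltac:(apply Rmin_pos; lra))
    as [d [Hd Hgap]].
  set (t1 := Rmin (d / 2) (T / 2)).
  assert (Ht1 : 0 < t1) by (apply Rmin_pos; lra).
  assert (Ht1d : t1 <= d / 2) by apply Rmin_l.
  assert (Ht1T : t1 <= T / 2) by apply Rmin_r.
  assert (M1 := Rmin_l (1 / 10) l); assert (M2 := Rmin_r (1 / 10) l).
  assert (Hg : forall t, 0 < t <= t1 -> 0 < gap t <= 3 / 5 * sqrt t).
  { intros t Ht; specialize (Hgap t ltac:(lra)); apply Rabs_def2 in Hgap.
    assert (Hs := sqrt_lt_R0 t ltac:(lra)).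
    replace (gap t) with (gap t / sqrt t * sqrt t) by (field; lra).
    split; [apply Rmult_lt_0_compat; lra | apply Rmult_le_compat_r; lra]. }
  destruct (expansion_at t1 ltac:(lra)) as (K & r & rho & HK & Hr & Hrho & Hb & Hser).
  (* Chosen so that |z|^2 <= 4 K^2 |zeta|^2 <= M y, using |zeta|^2 <= 2 y; adding 1 keeps M
     positive. *)
  set (M := 8 * (K + 1) ^ 2).
  assert (HM : 0 < M) by (apply Rmult_lt_0_compat; [lra | apply pow_lt; lra]).
  assert (HM2 : 0 < M ^ 3) by (apply pow_lt; lra).
  assert (Hr2 : 0 < r ^ 2) by (apply pow_lt; auto).
  (* The first two conditions place zeta where the series converges and is O(zeta), the third gives
     |z|^2 <= t1. The last contradicts 2 y^2 t1^2 <= 2 |z|^6 <= 2 M^3 y^3. *)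
  assert (Hy : exists y, 0 < y /\ 2 * y ^ 2 < rho /\ (2 * r ^ 2) * (2 * y) <= 1 / 2 /\
    M * y <= t1 /\ M ^ 3 * y < t1 ^ 2).
  { assert (0 < t1 ^ 2) by (apply pow_lt; auto).
    set (y := Rmin (Rmin 1 (rho / 4)) (Rmin (/ (8 * r ^ 2)) (Rmin (t1 / M) (t1 ^ 2 / (2 * M ^ 3))))).
    assert (Hy0 : 0 < y).
    { unfold y; repeat apply Rmin_pos; try lra;
        try (apply Rinv_0_lt_compat; lra); try (apply Rdiv_lt_0_compat; lra). }
    assert (L1 : y <= Rmin 1 (rho / 4)) by apply Rmin_l.
    assert (L2 : y <= Rmin (/ (8 * r ^ 2)) (Rmin (t1 / M) (t1 ^ 2 / (2 * M ^ 3)))) by apply Rmin_r.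
    assert (L3 : y <= 1) by (eapply Rle_trans; [exact L1 | apply Rmin_l]).
    assert (L4 : y <= rho / 4) by (eapply Rle_trans; [exact L1 | apply Rmin_r]).
    assert (L5 : y <= / (8 * r ^ 2)) by (eapply Rle_trans; [exact L2 | apply Rmin_l]).
    assert (L6 : y <= Rmin (t1 / M) (t1 ^ 2 / (2 * M ^ 3)))
      by (eapply Rle_trans; [exact L2 | apply Rmin_r]).
    assert (L7 : y <= t1 / M) by (eapply Rle_trans; [exact L6 | apply Rmin_l]).
    assert (L8 : y <= t1 ^ 2 / (2 * M ^ 3)) by (eapply Rle_trans; [exact L6 | apply Rmin_r]).
    clearbody y; exists y; split; [auto|]; split; [nra|]; split; [|split].
    - replace (1 / 2) with (4 * r ^ 2 * / (8 * r ^ 2)) by (field; lra).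
      replace (2 * r ^ 2 * (2 * y)) with (4 * r ^ 2 * y) by ring.
      apply Rmult_le_compat_l; lra.
    - replace t1 with (M * (t1 / M)) by (field; lra).
      apply Rmult_le_compat_l; lra.
    - assert (M ^ 3 * y <= M ^ 3 * (t1 ^ 2 / (2 * M ^ 3)))
        by (apply Rmult_le_compat_l; lra).
      replace (M ^ 3 * (t1 ^ 2 / (2 * M ^ 3))) with (t1 ^ 2 / 2) in * by (field; lra).
      lra. }
  destruct Hy as (y & Hy & Hy1 & Hy2 & Hy3 & Hy4).
  destruct (offset_preimage t1 y y ltac:(lra) Hy) as (z & Hz & Hs & E1 & E2).
  assert (Hlim := Hser z Hz Hs); rewrite E1, E2 in Hlim.
  specialize (Hlim Hy ltac:(nra)).
  set (zeta := Csqrt (y, y)) in *.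
  assert (Hz0 := Cmod_ge_0 zeta).
  assert (Hzeta : Cmod zeta ^ 2 <= 2 * y).
  { assert (N : Cmod zeta ^ 4 = y ^ 2 + y ^ 2) by apply Csqrt_norm.
    assert ((Cmod zeta ^ 2) ^ 2 = 2 * y ^ 2) by (rewrite <- pow_mult; simpl in *; lra).
    assert (0 <= Cmod zeta ^ 2) by apply pow2_ge_0.
    nra. }
  assert (Hzr : Cmod zeta * r <= 1 / 2).
  { assert ((Cmod zeta * r) ^ 2 <= 1 / 4).
    { rewrite Rpow_mult_distr.
      assert (Cmod zeta ^ 2 * r ^ 2 <= 2 * y * r ^ 2) by (apply Rmult_le_compat_r; lra).
      lra. }
    assert (0 <= Cmod zeta * r) by (apply Rmult_le_pos; lra). nra. }
  assert (HX := power_series_small _ K r zeta z HK Hr Hb Hzr Hlim).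
  set (X := Cmod z) in *.
  assert (HX0 : 0 <= X) by apply Cmod_ge_0.
  assert (HX2 : X ^ 2 <= M * y).
  { assert (X ^ 2 <= (2 * K * Cmod zeta) ^ 2) by (apply pow_incr; lra).
    replace ((2 * K * Cmod zeta) ^ 2) with (4 * K ^ 2 * Cmod zeta ^ 2) in * by ring.
    assert (0 <= K ^ 2 <= (K + 1) ^ 2) by (split; [apply pow2_ge_0 | apply pow_incr; lra]).
    assert (4 * K ^ 2 * Cmod zeta ^ 2 <= 4 * K ^ 2 * (2 * y))
      by (apply Rmult_le_compat_l; lra).
    assert (K ^ 2 * y <= (K + 1) ^ 2 * y) by (apply Rmult_le_compat_r; lra).
    unfold M; lra. }
  assert (Hdec := offset_decay t1 ltac:(lra) (fun t Ht => proj1 (Hg t Ht)) z Hz Hs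
    ltac:(lra) (fun t Ht => proj2 (Hg t Ht)) ltac:(fold X; lra)).
  rewrite E1, E2 in Hdec; fold X in Hdec.
  assert (HX6 : X ^ 6 <= (M * y) ^ 3).
  { replace (X ^ 6) with ((X ^ 2) ^ 3) by ring.
    apply pow_incr; split; [apply pow2_ge_0 | exact HX2]. }
  assert (Hyy : 0 < y ^ 2) by (apply pow_lt; auto).
  replace ((M * y) ^ 3) with (M ^ 3 * y * y ^ 2) in HX6 by ring.
  assert (M ^ 3 * y * y ^ 2 < t1 ^ 2 * y ^ 2) by (apply Rmult_lt_compat_r; auto).
  lra.
Qed.

(** * The majorant and the identification of the coefficients *)

Section CoefficientBound.

Variables B t0 K r : R.
Hypothesis B_pos : 0 < B.
Hypothesis t0_range : 0 < t0 < T.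
Hypothesis gap_bounds : forall t, 0 < t <= t0 ->
  sqrt t / 2 <= gap t /\ B * gap t ^ 2 <= t <= 4 * B * gap t ^ 2.
Hypothesis K_nonneg : 0 <= K.
Hypothesis r_pos : 0 < r.
Hypothesis coef_t0 : forall n, Cmod (bn (S n) t0) <= K * r ^ n.

Definition coef_majorant (t : R) : R := K / Rpower t0 B * Rpower t B.
(** The summand [r] makes the majorant dominate the true coefficients at [t0]; the first summand
    enforces the condition 5 <= s^2 D. *)
Definition radius_inv (t : R) : R := 4 * Rpower t (- (1 / 4)) + r.

Lemma gap_bounds_pos (t : R) : 0 < t <= t0 -> 0 < gap t.
Proof.
  intros Ht; destruct (gap_bounds t Ht) as [H _].
  assert (Hs := sqrt_lt_R0 t ltac:(lra)); lra.
Qed.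

Lemma radius_inv_pos (t : R) : 0 < radius_inv t.
Proof.
  unfold radius_inv; assert (0 < Rpower t (- (1 / 4))) by apply exp_pos; lra.
Qed.

Lemma radius_inv_decreasing (s t : R) : 0 < s <= t -> radius_inv t <= radius_inv s.
Proof.
  intros Hs; unfold radius_inv; rewrite !Rpower_Ropp.
  assert (H : Rpower s (1 / 4) <= Rpower t (1 / 4)) by (apply Rle_Rpower_l; lra).
  assert (/ Rpower t (1 / 4) <= / Rpower s (1 / 4)); [|lra].
  apply Rinv_le_contravar; [apply exp_pos | exact H].
Qed.

Lemma majorant_conditions (t : R) : 0 < t <= t0 ->
  is_derive coef_majorant t (B / t * coef_majorant t) /\
  is_derive radius_inv t (- (Rpower t (- (1 / 4)) / t)) /\
  0 <= coef_majorant t /\ 0 < radius_inv t /\ - (Rpower t (- (1 / 4)) / t) <= 0 /\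
  B / t * coef_majorant t <= B / t * coef_majorant t /\
  B / t * gap t ^ 2 <= 1 <= 4 * (B / t) * gap t ^ 2 /\
  5 <= radius_inv t ^ 2 * gap t.
Proof.
  intros Ht; destruct (gap_bounds t Ht) as [Hg [Hg1 Hg2]].
  assert (HD := gap_bounds_pos t Ht).
  assert (Hp : 0 < Rpower t0 B) by apply exp_pos.
  assert (Hq : 0 < Rpower t (- (1 / 4))) by apply exp_pos.
  split; [|split; [|split; [|split; [|split; [|split; [|split; [split|]]]]]]].
  - unfold coef_majorant; evar_last.
    + apply is_derive_scal, is_derive_Rpower; lra.
    + simpl; field; split; lra.
  - unfold radius_inv; evar_last.
    + apply is_derive_Rplus; [apply is_derive_scal, is_derive_Rpower; lra|].
      apply (is_derive_const (V := R_NormedModule)).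
    + unfold zero; simpl; field; lra.
  - apply Rmult_le_pos; [apply Rdiv_le_0_compat; lra | left; apply exp_pos].
  - apply radius_inv_pos.
  - assert (0 < Rpower t (- (1 / 4)) / t) by (apply Rdiv_lt_0_compat; lra); lra.
  - lra.
  - replace (B / t * gap t ^ 2) with (B * gap t ^ 2 / t) by (field; lra).
    apply (Rle_div_l (B * gap t ^ 2)); lra.
  - replace (4 * (B / t) * gap t ^ 2) with (4 * B * gap t ^ 2 / t) by (field; lra).
    apply (Rle_div_r 1); lra.
  (* The lower bound sqrt t / 2 for the gap gives s^2 D >= 16 t^(-1/2) sqrt t / 2 = 8, more than the
     required 5. *)
  - assert (Hs := sqrt_lt_R0 t ltac:(lra)).
    assert (E : Rpower t (- (1 / 4)) ^ 2 * sqrt t = 1).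
    { simpl; rewrite Rmult_1_r, <- Rpower_plus, <- Rpower_sqrt, <- Rpower_plus by lra.
      replace (- (1 / 4) + - (1 / 4) + / 2) with 0 by field.
      apply Rpower_O; lra. }
    assert (16 * Rpower t (- (1 / 4)) ^ 2 <= radius_inv t ^ 2)
      by (unfold radius_inv; nra).
    assert (0 <= radius_inv t ^ 2) by apply pow2_ge_0.
    assert (radius_inv t ^ 2 * (sqrt t / 2) <= radius_inv t ^ 2 * gap t)
      by (apply Rmult_le_compat_l; lra).
    assert (16 * Rpower t (- (1 / 4)) ^ 2 * (sqrt t / 2) <=
      radius_inv t ^ 2 * (sqrt t / 2)) by (apply Rmult_le_compat_r; lra).
    lra.
Qed.

(** With w = zeta^2 and h - lambda = D + w, the equation w' = - 2 w / (D (D + w)) is divided by 2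
    zeta. *)
Lemma sqrt_offset_derive (z : C) (t : R) :
  0 < t <= t0 -> upper_half z -> ~ slit gamma t0 z ->
  let zeta := fun s => Csqrt (offset_re z s, offset_im z s) in
  0 <= offset_re z t ->
  cderive zeta t (zeta t * (- / (gap t * (gap t + zeta t ^ 2))))%C.
Proof.
  intros Ht Hz Hs zeta HA.
  assert (HD := gap_bounds_pos t Ht).
  destruct (offset_derive z t ltac:(lra) Hz
    (not_slit_le z t t0 (proj2 Ht) Hs) HD) as (HI & Hd1 & Hd2).
  assert (Hloc : locally t (fun s => 0 < offset_im z s)).
  { apply (is_derive_cont _ _ _ Hd2 (fun v => 0 < v)).
    apply (open_gt 0), HI. }
  assert (H := cderive_Csqrt _ _ t _ _ HI Hloc Hd1 Hd2).
  fold zeta in H.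
  assert (Hsq : (zeta t ^ 2)%C = (offset_re z t, offset_im z t)).
  { apply Csqrt_pow2. }
  assert (Hzne : zeta t <> RtoC 0).
  { intros E; rewrite E in Hsq; apply (f_equal Im) in Hsq; simpl in Hsq; lra. }
  assert (HDne : RtoC (gap t) <> RtoC 0) by (intros E; apply RtoC_inj in E; lra).
  assert (Hne : (gap t + zeta t ^ 2 <> RtoC 0)%C).
  { rewrite Hsq; intros E; apply (f_equal Im) in E; simpl in E; lra. }
  match type of H with cderive _ _ (?d / _)%C =>
    replace d with (- 2 * zeta t ^ 2 / (gap t * (gap t + zeta t ^ 2)))%C in H end.
  - match type of H with cderive _ _ ?k =>
      match goal with |- cderive _ _ ?l => replace l with k; [exact H|] end end.
    change (Csqrt (offset_re z t, offset_im z t)) with (zeta t).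
    field; repeat split; try assumption.
  - assert (Hgv : 0 < gap t * offset_im z t) by (apply Rmult_lt_0_compat; auto).
    assert (P1 : 0 < (offset_re z t + gap t) * (offset_re z t + gap t) +
      offset_im z t * offset_im z t)
      by (apply Rplus_le_lt_0_compat; [apply Rle_0_sqr | apply Rmult_lt_0_compat; auto]).
    assert (P2 : 0 < gap t * (gap t + offset_re z t) * (gap t * (gap t + offset_re z t)) +
      gap t * offset_im z t * (gap t * offset_im z t))
      by (apply Rplus_le_lt_0_compat; [apply Rle_0_sqr | apply Rmult_lt_0_compat; auto]).
    rewrite Hsq; unfold sing_sqdist; apply injective_projections; simpl; field;
      repeat split; lra.
Qed.

Lemma coefficient_bound (tau : R) (n : nat) : 0 < tau <= t0 ->
  Cmod (bn (S n) tau) <= 2 * (coef_majorant tau * radius_inv tau ^ n).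
Proof.
  intros Htau.
  (* Clamping the time makes the gap continuous and positive on all of R. *)
  set (clamp := fun t => Rmax tau (Rmin t t0)).
  assert (Hcl : forall t, tau <= clamp t <= t0).
  { intros t; unfold clamp, Rmax, Rmin; repeat destruct Rle_dec; lra. }
  assert (Hcl_id : forall t, tau <= t <= t0 -> clamp t = t).
  { intros t Ht; unfold clamp; rewrite Rmin_left, Rmax_right; lra. }
  set (D := fun t => gap (clamp t)).
  assert (D_cont : forall t, continuous D t).
  { intros t; apply (continuous_comp clamp gap).
    - apply filterlim_locally; intros eps; exists eps; intros s Hs.
      change (Rabs (s - t) < eps) in Hs; change (Rabs (clamp s - clamp t) < eps).
      apply Rabs_def2 in Hs; apply Rabs_def1; unfold clamp, Rmax, Rmin;
        repeat destruct Rle_dec; lra.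
    - apply gap_continuous; specialize (Hcl t); lra. }
  assert (D_pos : forall t, 0 < D t).
  { intros t; apply gap_bounds_pos; specialize (Hcl t); lra. }
  assert (D_id : forall t, tau <= t <= t0 -> D t = gap t).
  { intros t Ht; unfold D; rewrite Hcl_id; auto. }
  (* The system has real coefficients, so real and imaginary parts evolve separately; each obeys the
     majorant, whence the factor 2 in the bound. Index 0 gets the value 0, as the expansion has no
     constant term. *)
  set (ar := fun n => match n with O => 0 | S m => Re (bn (S m) t0) end).
  set (ai := fun n => match n with O => 0 | S m => Im (bn (S m) t0) end).
  set (br := flow_beta D t0 ar); set (bi := flow_beta D t0 ai).
  set (er := flow_e D t0 ar); set (ei := flow_e D t0 ai).
  assert (Fr : coefficient_flow D br er) by (apply flow_solves; auto).
  assert (Fi : coefficient_flow D bi ei) by (apply flow_solves; auto).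
  assert (Hcond : forall t, tau <= t <= t0 ->
    is_derive coef_majorant t (B / t * coef_majorant t) /\
    is_derive radius_inv t (- (Rpower t (- (1 / 4)) / t)) /\
    0 <= coef_majorant t /\ 0 < radius_inv t /\ - (Rpower t (- (1 / 4)) / t) <= 0 /\
    B / t * coef_majorant t <= B / t * coef_majorant t /\
    B / t * D t ^ 2 <= 1 <= 4 * (B / t) * D t ^ 2 /\ 5 <= radius_inv t ^ 2 * D t).
  { intros t Ht; rewrite (D_id t Ht); apply majorant_conditions; lra. }
  assert (Hinit : forall n, K * r ^ n <= coef_majorant t0 * radius_inv t0 ^ n).
  { intros k; unfold coef_majorant.
    assert (Hp : 0 < Rpower t0 B) by apply exp_pos.
    replace (K / Rpower t0 B * Rpower t0 B) with K by (field; lra).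
    apply Rmult_le_compat_l; [auto|]; apply pow_incr; unfold radius_inv.
    assert (0 < Rpower t0 (- (1 / 4))) by apply exp_pos; lra. }
  assert (Br := flow_majorant D coef_majorant (fun t => B / t * coef_majorant t) radius_inv
    (fun t => - (Rpower t (- (1 / 4)) / t)) (fun t => B / t) br er tau t0
    D_cont D_pos Fr (proj2 Htau) Hcond).
  assert (Bi := flow_majorant D coef_majorant (fun t => B / t * coef_majorant t) radius_inv
    (fun t => - (Rpower t (- (1 / 4)) / t)) (fun t => B / t) bi ei tau t0
    D_cont D_pos Fi (proj2 Htau) Hcond).
  assert (Ir : forall n, br (S n) t0 = Re (bn (S n) t0))
    by (intros k; apply (flow_init D t0 ar (S k)); reflexivity).
  assert (Ii : forall n, bi (S n) t0 = Im (bn (S n) t0))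
    by (intros k; apply (flow_init D t0 ai (S k)); reflexivity).
  specialize (Br ltac:(intros k; rewrite Ir; eapply Rle_trans;
    [apply re_le_Cmod|]; eapply Rle_trans; [apply coef_t0 | apply Hinit])).
  specialize (Bi ltac:(intros k; rewrite Ii; eapply Rle_trans;
    [eapply Rle_trans; [apply Rmax_r | apply (Rmax_Cmod (bn (S k) t0))]|];
    eapply Rle_trans; [apply coef_t0 | apply Hinit])).
  assert (HBc : forall k, Cmod (flow_coef br bi (S k) tau) <=
    2 * (coef_majorant tau * radius_inv tau ^ k)).
  { intros k; eapply Rle_trans; [apply Cmod_pair_le|].
    destruct (Br k tau ltac:(lra)) as [H1 _]; destruct (Bi k tau ltac:(lra)) as [H2 _].
    lra. }
  destruct (expansion_at t0 ltac:(lra)) as (K0 & r0 & rho0 & _ & _ & Hrho0 & _ & Ser0).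
  destruct (expansion_at tau ltac:(lra))
    as (K1 & r1 & rho1 & HK1 & Hr1 & Hrho1 & Hb1 & Ser1).
  assert (HS := radius_inv_pos tau).
  assert (HM : 0 <= coef_majorant tau) by (apply (Hcond tau); lra).
  assert (Heq : forall k, (bn (S k) tau - flow_coef br bi (S k) tau)%C = RtoC 0).
  { apply (power_series_unique _ (K1 + 2 * coef_majorant tau) (r1 + radius_inv tau));
      [lra | lra | |].
    - intros k; eapply Rle_trans; [apply Cmod_triangle|]; rewrite Cmod_opp.
      specialize (Hb1 k); specialize (HBc k).
      assert (r1 ^ k <= (r1 + radius_inv tau) ^ k) by (apply pow_incr; lra).
      assert (radius_inv tau ^ k <= (r1 + radius_inv tau) ^ k) by (apply pow_incr; lra).
      nra.
    - intros eta Heta.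
      (* A target size for zeta on all of [tau, t0]: it meets the demands of the transport and of
         the expansions at both times, where |h - h^+|^2 < x^4 <= x. *)
      assert (Hx : exists x, 0 < x <= 1 /\ x < eta /\ x * radius_inv tau <= 1 / 2 /\
        x <= rho0 /\ x <= rho1).
      { set (x := Rmin (Rmin 1 (eta / 2)) (Rmin (/ (2 * radius_inv tau)) (Rmin rho0 rho1))).
        assert (Hx0 : 0 < x).
        { unfold x; repeat apply Rmin_pos; try lra; apply Rinv_0_lt_compat; lra. }
        assert (L1 : x <= Rmin 1 (eta / 2)) by apply Rmin_l.
        assert (L2 : x <= Rmin (/ (2 * radius_inv tau)) (Rmin rho0 rho1)) by apply Rmin_r.
        assert (L3 := Rmin_l 1 (eta / 2)); assert (L4 := Rmin_r 1 (eta / 2)).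
        assert (L5 := Rmin_l (/ (2 * radius_inv tau)) (Rmin rho0 rho1)).
        assert (L6 := Rmin_r (/ (2 * radius_inv tau)) (Rmin rho0 rho1)).
        assert (L7 := Rmin_l rho0 rho1); assert (L8 := Rmin_r rho0 rho1).
        clearbody x; exists x; repeat split; try lra.
        replace (1 / 2) with (/ (2 * radius_inv tau) * radius_inv tau) by (field; lra).
        apply Rmult_le_compat_r; lra. }
      destruct Hx as (x & Hx1 & Hxeta & HxS & Hx0' & Hx1').
      (* G bounds the backward growth of |h - h^+|^2 from [t0] to [tau]. With y = x^2 / (2 G) one
         gets 2 y^2 G = x^4 / (2 G) < x^4, hence |zeta| < x throughout. *)
      set (G := exp (16 * t0 / tau)).
      assert (HG : 1 <= G).
      { assert (0 <= 16 * t0 / tau) by (apply Rdiv_le_0_compat; lra).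
        generalize (exp_ineq1_le (16 * t0 / tau)); unfold G; lra. }
      set (y := x ^ 2 / (2 * G)).
      assert (Hx2 : 0 < x ^ 2) by (apply pow_lt; lra).
      assert (Hy : 0 < y) by (apply Rdiv_lt_0_compat; lra).
      assert (HyG : (y ^ 2 + y ^ 2) * G < x ^ 4).
      { replace ((y ^ 2 + y ^ 2) * G) with (x ^ 4 / 2 / G) by (unfold y; field; lra).
        assert (0 < x ^ 4) by (apply pow_lt; lra).
        apply (Rlt_div_l (x ^ 4 / 2)); nra. }
      destruct (offset_preimage t0 y y ltac:(lra) Hy) as (z & Hz & Hs & E1 & E2).
      assert (Hsec : offset_im z t0 <= offset_re z t0) by lra.
      set (zeta := fun s => Csqrt (offset_re z s, offset_im z s)).
      assert (Hfl := fun t Ht => offset_flow t0 t0_range gap_bounds_pos z Hz Hs t Ht).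
      assert (Hup : forall t, tau <= t <= t0 ->
        offset_re z t ^ 2 + offset_im z t ^ 2 < x ^ 4).
      { intros t Ht; eapply Rle_lt_trans; [|exact HyG].
        replace (y ^ 2 + y ^ 2) with (offset_re z t0 ^ 2 + offset_im z t0 ^ 2)
          by (rewrite E1, E2; reflexivity).
        apply offset_upper; auto; try lra.
        - exact gap_bounds_pos.
        - intros s Hs'; apply gap_bounds; exact Hs'. }
      assert (Hx4 : x ^ 4 <= x).
      { replace (x ^ 4) with (x * x ^ 3) by ring.
        assert (x ^ 3 <= 1 ^ 3) by (apply pow_incr; lra).
        assert (0 <= x ^ 3) by (apply pow_le; lra). nra. }
      assert (Hzx : forall t, tau <= t <= t0 -> Cmod (zeta t) < x).
      { intros t Ht; apply Rnot_le_lt; intros H.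
        assert (H4 : x ^ 4 <= Cmod (zeta t) ^ 4) by (apply pow_incr; lra).
        unfold zeta in H4; rewrite Csqrt_norm in H4; specialize (Hup t Ht); lra. }
      assert (HI : forall t, tau <= t <= t0 -> 0 < offset_im z t)
        by (intros t Ht; apply Hfl; lra).
      assert (Hre : forall t, tau <= t <= t0 -> 0 < offset_re z t).
      { intros t Ht; eapply Rlt_le_trans; [apply (HI t Ht)|].
        apply (offset_sector t0); auto; try lra. exact gap_bounds_pos. }
      assert (Hsq : forall t, (zeta t ^ 2)%C = (offset_re z t, offset_im z t)).
      { intros t; apply Csqrt_pow2. }
      exists (zeta tau); split; [|split].
      + intros E; specialize (Hsq tau); rewrite E in Hsq.
        apply (f_equal Im) in Hsq; simpl in Hsq; specialize (HI tau ltac:(lra)); lra.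
      + specialize (Hzx tau ltac:(lra)); lra.
      + assert (L0 := Ser0 z Hz Hs (HI t0 ltac:(lra))
          ltac:(specialize (Hup t0 ltac:(lra)); lra)).
        assert (L1 := Ser1 z Hz (not_slit_le z tau t0 (proj2 Htau) Hs) (HI tau ltac:(lra))
          ltac:(specialize (Hup tau ltac:(lra)); lra)).
        assert (Htr : clim (fun N => flow_sum br bi zeta N t0 - flow_sum br bi zeta N tau)%C (RtoC 0)).
        { apply (flow_sum_transport D coef_majorant radius_inv br er bi ei zeta tau t0 Fr Fi D_pos
            (sqrt tau / 2) (coef_majorant t0)); [lra | |].
          - assert (Hst := sqrt_lt_R0 tau ltac:(lra)); lra.
          - intros t Ht.
            assert (Hzt := Hzx t Ht).
            assert (HSt := radius_inv_pos t).
            assert (HSS := radius_inv_decreasing tau t ltac:(lra)).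
            assert (Hc0 := Cmod_ge_0 (zeta t)).
            rewrite (D_id t Ht).
            split; [|split; [|split; [|split; [|split; [|split; [|split]]]]]].
            + eapply Rle_trans; [|apply (gap_bounds t); lra].
              assert (sqrt tau <= sqrt t) by (apply sqrt_le_1_alt; lra); lra.
            + rewrite Hsq; simpl; left; apply Hre, Ht.
            + lra.
            + nra.
            + lra.
            + unfold coef_majorant; apply Rmult_le_compat_l.
              * apply Rdiv_le_0_compat; [lra | apply exp_pos].
              * apply Rle_Rpower_l; lra.
            + apply sqrt_offset_derive; auto; [lra|]. left; apply Hre, Ht.
            + intros k; split; [apply Br | apply Bi]; exact Ht. }
        (* Both expansions sum to the same z, at [tau] and at [t0]. The flow agrees with [bn] at
           [t0], so the transport makes the series of the differences at [tau] sum to 0. *)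
        assert (H := clim_minus _ _ _ _ L1 (clim_minus _ _ _ _ L0 Htr)).
        replace (z - (z - RtoC 0))%C with (RtoC 0) in H by ring.
        eapply clim_ext; [|exact H]; intros N; cbv beta.
        transitivity (csum (fun k => bn (S k) tau * zeta tau ^ S k -
          flow_coef br bi (S k) tau * zeta tau ^ S k)%C N).
        2:{ apply csum_ext; intros k; ring. }
        rewrite csum_minus; unfold flow_sum.
        replace (csum (fun k => flow_coef br bi (S k) t0 * zeta t0 ^ S k)%C N) with
          (csum (fun k => bn (S k) t0 * zeta t0 ^ S k)%C N).
        * unfold zeta; ring.
        * apply csum_ext; intros k; unfold flow_coef; rewrite Ir, Ii.
          destruct (bn (S k) t0); reflexivity. }
  replace (bn (S n) tau) with (flow_coef br bi (S n) tau); [apply HBc|].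
  specialize (Heq n).
  replace (bn (S n) tau) with ((bn (S n) tau - flow_coef br bi (S n) tau) + flow_coef br bi (S n) tau)%C
    by ring.
  rewrite Heq; ring.
Qed.

End CoefficientBound.

End Loewner.

(** * Choice of the exponents and of delta *)

Lemma Rpower_absorbs_constant (L a : R) :
  0 < L -> 0 < a -> exists delta, 0 < delta /\
    forall t, 0 < t < delta -> L <= Rpower t (- a).
Proof.
  intros HL Ha; exists (exp (- ln L / a)); split; [apply exp_pos|].
  intros t Ht; unfold Rpower.
  rewrite <- (exp_ln L) at 1 by assumption.
  assert (H : ln t < - ln L / a).
  { rewrite <- (ln_exp (- ln L / a)); apply ln_increasing; apply Ht. }
  left; apply exp_increasing.
  assert (a * ln t < a * (- ln L / a)) by (apply Rmult_lt_compat_l; auto).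
  replace (a * (- ln L / a)) with (- ln L) in * by (field; lra); lra.
Qed.

Lemma Rpower_antitone_exponent (t x y : R) :
  0 < t <= 1 -> y <= x -> Rpower t x <= Rpower t y.
Proof.
  intros Ht Hxy; unfold Rpower.
  assert (H : ln t <= 0) by (rewrite <- ln_1; apply ln_le; lra).
  destruct (Rle_lt_or_eq_dec (x * ln t) (y * ln t)) as [E|E]; [nra| |].
  - left; apply exp_increasing, E.
  - rewrite E; apply Rle_refl.
Qed.

Lemma Rpower_quarter_pow (t : R) (n : nat) :
  Rpower t (- (1 / 4)) ^ n = Rpower t (- (INR n / 4)).
Proof.
  rewrite <- Rpower_pow by apply exp_pos; rewrite Rpower_mult; f_equal; field.
Qed.

Lemma gap_asymptotics (D : R -> R) (l B : R) :
  filterlim (fun t => D t / sqrt t) (at_right 0) (locally l) ->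
  1 / 2 < l -> 1 / 2 <= B * l ^ 2 < 1 ->
  exists delta, 0 < delta /\ forall t, 0 < t < delta ->
    sqrt t / 2 <= D t /\ B * D t ^ 2 <= t <= 4 * B * D t ^ 2.
Proof.
  intros Hlim Hl HB.
  assert (Hl2 : 0 < l ^ 2) by (apply pow_lt; lra).
  assert (HB0 : 0 < B) by nra.
  (* The four terms serve in turn: g >= 1 / 2; g >= 3 l / 4, so that 4 B g^2 >= 2 B l^2 >= 1; e^2 <=
     e; and (l + e)^2 <= l^2 + e (2 l + 1) <= 1 / B. *)
  set (e := Rmin (Rmin (l - 1 / 2) (l / 4)) (Rmin 1 ((1 / B - l ^ 2) / (2 * l + 1)))).
  assert (HBl : l ^ 2 < 1 / B) by (apply (Rlt_div_r (l ^ 2)); lra).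
  assert (He : 0 < e).
  { repeat apply Rmin_pos; try lra; apply Rdiv_lt_0_compat; lra. }
  assert (L1 : e <= Rmin (l - 1 / 2) (l / 4)) by apply Rmin_l.
  assert (L2 : e <= Rmin 1 ((1 / B - l ^ 2) / (2 * l + 1))) by apply Rmin_r.
  assert (L3 := Rmin_l (l - 1 / 2) (l / 4)); assert (L4 := Rmin_r (l - 1 / 2) (l / 4)).
  assert (L5 := Rmin_l 1 ((1 / B - l ^ 2) / (2 * l + 1))).
  assert (L6 := Rmin_r 1 ((1 / B - l ^ 2) / (2 * l + 1))).
  clearbody e.
  destruct (at_right_0_elim _ _ e Hlim He) as [d [Hd H]].
  exists d; split; [exact Hd|]; intros t Ht.
  specialize (H t Ht); apply Rabs_def2 in H.
  assert (Hs := sqrt_lt_R0 t ltac:(lra)); assert (Hss := sqrt_sqrt t ltac:(lra)).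
  set (g := D t / sqrt t) in *.
  assert (ED : D t = g * sqrt t) by (unfold g; field; lra).
  assert (ED2 : D t ^ 2 = g ^ 2 * t).
  { transitivity (g ^ 2 * (sqrt t * sqrt t)); [rewrite ED; ring | rewrite Hss; reflexivity]. }
  assert (Hg2 : g ^ 2 <= 1 / B).
  { assert (e * (2 * l + 1) <= 1 / B - l ^ 2).
    { replace (1 / B - l ^ 2) with ((1 / B - l ^ 2) / (2 * l + 1) * (2 * l + 1))
        by (field; lra).
      apply Rmult_le_compat_r; lra. }
    assert (g ^ 2 <= (l + e) ^ 2) by (apply pow_incr; lra).
    nra. }
  assert (Hg2' : l ^ 2 / 2 <= g ^ 2).
  { assert ((3 / 4 * l) ^ 2 <= g ^ 2) by (apply pow_incr; lra). nra. }
  split; [rewrite ED; nra|]; rewrite ED2; split.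
  - assert (B * g ^ 2 <= B * (1 / B)) by (apply Rmult_le_compat_l; lra).
    replace (B * (1 / B)) with 1 in * by (field; lra).
    nra.
  - assert (B * (l ^ 2 / 2) <= B * g ^ 2) by (apply Rmult_le_compat_l; lra).
    nra.
Qed.

Theorem theorem4 :
  exists A : nat -> R,
  forall (T : R) (lambda : R -> R) (gamma : R -> C) (h hinv : C -> R -> C)
         (hm hp : R -> R) (b c : R) (bn : nat -> R -> C),
    0 < T ->
    Lip_half T lambda ->
    simple_slit T gamma ->
    analytic_symmetric_slit T gamma ->
    loewner_slit_maps T lambda gamma h ->
    reflected_slit_maps T lambda gamma h hm hp ->
    filterlim (fun t => lambda t / sqrt t) (at_right 0) (locally c) ->
    filterlim (fun t => hp t / sqrt t) (at_right 0) (locally b) ->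
    c < b <= (c + sqrt (c ^ 2 + 16)) / 2 ->
    (forall t, 0 < t <= T ->
       inverse_onto (fun z => h z t) (fun w => hinv w t)
         (setC (double_slit gamma t)) (setC (real_interval (hm t) (hp t)))) ->
    (forall t, 0 < t <= T ->
       half_power_expansion (fun w => hinv w t)
         (setC (real_interval (hm t) (hp t))) (hp t) (fun n => bn n t)) ->
    forall eps : R, 0 < eps ->
    exists delta : R, 0 < delta /\
      forall n : nat, Nat.Odd n -> (1 < n)%nat ->
      forall t : R, 0 < t < delta ->
        Cmod (bn n t) <=
          A n * Rpower t (1 / (b - c) ^ 2 - (INR n - 1) / 4 - eps).
Proof.
  exists (fun n => 8 ^ pred n).
  intros T lambda gamma h hinv hm hp b c bn HT Hlip Hslit _ Hlo Hre Hlam Hhp Hbc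
    Hinv Hexp eps Heps.
  set (l := b - c); assert (Hl0 : 0 < l) by (unfold l; lra).
  assert (Hlim : filterlim (fun t => gap lambda hp t / sqrt t) (at_right 0) (locally l)).
  { apply (filterlim_ext (fun t => hp t / sqrt t - lambda t / sqrt t)).
    - intros t; unfold gap, Rdiv; ring.
    - exact (filterlim_comp_2 _ _ Rplus Hhp
        (filterlim_comp _ _ _ _ _ _ _ _ Hlam (filterlim_opp (V := R_NormedModule) c))
        (filterlim_plus (V := R_NormedModule) b (- c))). }
  assert (Hl := gap_ratio_gt_half T lambda gamma h hinv hm hp bn HT Hslit Hlo Hre
    Hinv Hexp l Hl0 Hlim).
  assert (Hl2 : 0 < l ^ 2) by (apply pow_lt; lra).
  assert (HB0 : 0 < 1 / l ^ 2) by (apply Rdiv_lt_0_compat; lra).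
  (* Half of [e] separates B from 1 / l^2, the other half absorbs the constant [M]. The cap 1 / l^2
     keeps B positive and B l^2 >= 1 / 2. *)
  set (e := Rmin eps (1 / l ^ 2)).
  assert (He : 0 < e) by (apply Rmin_pos; auto).
  assert (He1 : e <= eps) by apply Rmin_l.
  assert (He2 : e <= 1 / l ^ 2) by apply Rmin_r.
  set (B := 1 / l ^ 2 - e / 2).
  assert (HB : 0 < B) by (unfold B; lra).
  assert (HBl : 1 / 2 <= B * l ^ 2 < 1).
  { assert (E : B * l ^ 2 = 1 - e * l ^ 2 / 2) by (unfold B; field; lra).
    assert (e * l ^ 2 <= 1).
    { replace 1 with (1 / l ^ 2 * l ^ 2) at 1 by (field; lra).
      apply Rmult_le_compat_r; lra. }
    assert (0 < e * l ^ 2) by (apply Rmult_lt_0_compat; auto). lra. }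
  destruct (gap_asymptotics _ l B Hlim Hl HBl) as [d1 [Hd1 Hgap]].
  set (t0 := Rmin (d1 / 2) (Rmin 1 (T / 2))).
  assert (Ht0 : 0 < t0) by (repeat apply Rmin_pos; lra).
  assert (Ht0d : t0 <= d1 / 2) by apply Rmin_l.
  assert (Ht0' : t0 <= Rmin 1 (T / 2)) by apply Rmin_r.
  assert (M1 := Rmin_l 1 (T / 2)); assert (M2 := Rmin_r 1 (T / 2)).
  destruct (expansion_at T lambda gamma h hinv hm hp bn Hslit Hlo Hinv Hexp t0 ltac:(lra))
    as (K & r & _ & HK & Hr & _ & Hcoef & _).
  assert (Hbound := coefficient_bound T lambda gamma h hinv hm hp bn Hlip Hslit Hlo Hre
    Hinv Hexp B t0 K r HB ltac:(lra) ltac:(intros t Ht; apply Hgap; lra) HK Hr Hcoef).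
  set (M := 2 * (K / Rpower t0 B) + 1).
  assert (HK0 : 0 <= K / Rpower t0 B) by (apply Rdiv_le_0_compat; [lra | apply exp_pos]).
  assert (HM : 0 < M) by (unfold M; lra).
  destruct (Rpower_absorbs_constant M (e / 2) HM ltac:(lra)) as [d2 [Hd2 HMt]].
  (* Comparing [r] with t^(-1/4) inside the base gives a threshold independent of [n]; afterwards
     the base is at most 5 t^(-1/4), within the constant 8. *)
  destruct (Rpower_absorbs_constant r (1 / 4) Hr ltac:(lra)) as [d3 [Hd3 Hrt]].
  exists (Rmin t0 (Rmin d2 d3)).
  split; [repeat apply Rmin_pos; lra|].
  intros n _ Hn t Ht.
  assert (N1 := Rmin_l t0 (Rmin d2 d3)); assert (N2 := Rmin_r t0 (Rmin d2 d3)).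
  assert (N3 := Rmin_l d2 d3); assert (N4 := Rmin_r d2 d3).
  specialize (HMt t ltac:(lra)); specialize (Hrt t ltac:(lra)).
  destruct n as [|m]; [lia|]; simpl pred.
  eapply Rle_trans; [apply Hbound; lra|].
  unfold coef_majorant, radius_inv.
  assert (Hq : 0 < Rpower t (- (1 / 4))) by apply exp_pos.
  assert (Hs : (4 * Rpower t (- (1 / 4)) + r) ^ m <= 8 ^ m * Rpower t (- (INR m / 4))).
  { rewrite <- Rpower_quarter_pow, <- Rpow_mult_distr; apply pow_incr; lra. }
  assert (HtB : 0 < Rpower t B) by apply exp_pos.
  assert (H8 : 0 < 8 ^ m) by (apply pow_lt; lra).
  assert (Hpow : 0 <= (4 * Rpower t (- (1 / 4)) + r) ^ m) by (apply pow_le; lra).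
  apply Rle_trans with
    (Rpower t (- (e / 2)) * Rpower t B * (8 ^ m * Rpower t (- (INR m / 4)))).
  - replace (2 * (K / Rpower t0 B * Rpower t B * (4 * Rpower t (- (1 / 4)) + r) ^ m))
      with (2 * (K / Rpower t0 B) * Rpower t B * (4 * Rpower t (- (1 / 4)) + r) ^ m) by ring.
    apply Rmult_le_compat; auto.
    + apply Rmult_le_pos; lra.
    + apply Rmult_le_compat_r; [lra|]; unfold M in HMt; lra.
  - replace (Rpower t (- (e / 2)) * Rpower t B * (8 ^ m * Rpower t (- (INR m / 4)))) with
      (8 ^ m * (Rpower t (- (e / 2)) * Rpower t B * Rpower t (- (INR m / 4)))) by ring.
    apply Rmult_le_compat_l; [lra|].
    rewrite <- !Rpower_plus; apply Rpower_antitone_exponent; [lra|].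
    rewrite S_INR; fold l; unfold B; lra.
Qed.
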